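(* Let $d=1$ and let $\{X_e : e\in E\}$ be i.i.d. $\mathcal{N}(0,1)$ random variables. Then for every sufficiently small $\varepsilon>0$, $$-\infty<\liminf_{n\to\infty}\frac{\log n}{n^2}\log P\big(Z_n\le(\mu-\varepsilon)n\big)\le\limsup_{n\to\infty}\frac{\log n}{n^2}\log P\big(Z_n\le(\mu-\varepsilon)n\big)<0 .$$
   Context: $\log$ denotes the logarithm to base 2. Let $\Xi=\{(x,n)\in\mathbb{Z}\times\mathbb{Z}_+ : |x|+n\equiv 0 \bmod 2\}$ ($\mathbb{Z}_+$ includes $0$), and let $E$ be the set of directed edges from $(x,n)\in\Xi$ to $(x\pm 1,n+1)$. Let $\aleph_n$ be the set of directed nearest-neighbour paths in $(\Xi,E)$ with $n$ steps starting at $(0,0)$. Write $e\in\gamma$ if the edge $e$ is traversed by $\gamma$, and set $Z_n=\sup_{\gamma\in\aleph_n}\sum_{e\in\gamma}X_e$. The constant $\mu$ is the nonrandom almost sure limit $\mu=\lim_{n\to\infty} Z_n/n$. *)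

(* Defs.v *)
From HB Require Import structures.
From mathcomp Require Import all_boot all_order all_algebra finmap.
From mathcomp Require Import all_classical all_reals all_analysis.

Set Implicit Arguments.
Unset Strict Implicit.
Unset Printing Implicit Defensive.

Import Order.TTheory GRing.Theory Num.Theory.
Import numFieldNormedType.Exports.

Local Open Scope classical_set_scope.
Local Open Scope ring_scope.

Section logarithm.
Context {R : realType}.

Definition log2 (x : R) : R := ln x / ln 2.

(* The extended version is needed for probabilities: [log2e 0 = -oo], whereas
   the real-valued [ln 0] is [0]. *)
Definition log2e (x : \bar R) : \bar R := (lne x * ((ln 2)^-1)%:E)%E.

End logarithm.

Section independence.
Context d (T : measurableType d) (R : realType) (P : probability T R).

(* The family (X_i) indexed by i in D; the values of X outside D are
   irrelevant. *)
Definition mutually_independent (I : choiceType) (D : set I)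
    (X : I -> {RV P >-> R}) : Prop :=
  forall (J : {fset I}) (A : I -> set R),
    [set` J] `<=` D ->
    (forall i, i \in J -> measurable (A i)) ->
    P (\bigcap_(i in [set` J]) (X i @^-1` A i)) =
      (\prod_(i <- J) P (X i @^-1` A i))%E.

(* Measures are compared on measurable sets only, as their values elsewhere
   are unspecified. *)
Definition has_law (X : {RV P >-> R}) (nu : set R -> \bar R) : Prop :=
  forall A : set R, measurable A -> distribution P X A = nu A.

End independence.

Section lattice.

Definition point : Type := (int * nat)%type.

Definition Xi : pred point := [pred v | ~~ odd (`|v.1|%N + v.2)].

Definition is_edge : rel point := fun u v =>
  [&& u \in Xi, (v.1 == u.1 + 1) || (v.1 == u.1 - 1) & v.2 == u.2.+1].

(* Directed edges are pairs (tail, head). *)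
Definition E : set (point * point) := [set e | is_edge e.1 e.2].

Definition origin : point := (0, 0%N).

(* A path is the sequence of its n vertices after the origin. *)
Definition aleph (n : nat) : set (seq point) :=
  [set g | size g = n /\ path is_edge origin g].

(* No edge is repeated along a path, since the second coordinate increases. *)
Definition edges_of (g : seq point) : seq (point * point) :=
  zip (origin :: g) g.

(* The supremum is over a finite nonempty set of reals. *)
Definition Z {R : realType} (x : point * point -> R) (n : nat) : R :=
  sup [set \sum_(e <- edges_of g) x e | g in aleph n].

End lattice.

(* Main.v *)
(* Lower bound on the probability: all the edges leaving level [k < m], with
   [m] of order [n ^ (1 / 3)], are forced below [- c / k].  There are of order
   [k] of them, so this costs [exp (- C c^2 log m)] while every path loses
   [c log m]; take [c] of order [n / log n].

   Upper bound: average over [M ~ n] paths.  Each of them first follows one of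
   [M] rays from the origin; since about [M / k] rays share an edge of level
   [k], the average over the rays is a centred Gaussian of variance of order
   [log n], which is below [- e n] with probability [exp (- c n^2 / log n)].
   Each path then stays in a strip of bounded width of its own and crosses
   layers of fixed height [N]: in each layer it follows a path of weight at least
   [(mu - e) N] that does not move away from the axis of the strip if there is
   one, and a straight path otherwise.  By the reflection symmetry and the Harris
   inequality such a path exists with probability close to 1, so an exponential
   Chebyshev inequality over the independent strips and layers gives a failure
   probability [exp (- c n^2)].

   All the independence used is the invariance of the joint law under resampling
   one coordinate. *)

Require Import Defs.
From HB Require Import structures.
From mathcomp Require Import all_boot all_order all_algebra finmap.
From mathcomp Require Import all_classical all_reals all_analysis.
From mathcomp Require Import measurable_realfun.
From mathcomp Require Import ring lra zify.

Set Implicit Arguments.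
Unset Strict Implicit.
Unset Printing Implicit Defensive.

Import Order.TTheory GRing.Theory Num.Theory.
Import numFieldNormedType.Exports.

Local Open Scope classical_set_scope.
Local Open Scope ring_scope.

(** * Configurations and resampling *)

(** One extremal problem governs both bounds. Lowering all paths near the origin means shifting the
    order of [k] edges of level [k] by some [a k]. The Gaussian cost is the sum of [k (a k)^2];
    minimised when the [a k] sum to [c n], it gives [a k] proportional to [1 / k] and a cost of
    order [n^2 / log n]. Dually, spreading unit mass evenly over about [k] vertices of level [k]
    leaves a variance [1 / k] there, and these sum to a logarithm. So the rays must first separate
    the paths to linear distance, and only this stage costs the logarithm. Beyond it, exponential
    Chebyshev wants of order [n^2] independent blocks of mean weight close to [mu] per step, hence
    blocks of fixed size. Concatenated optimal block paths would drift out of their strips and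
    destroy independence; steering each of them back costs only a square root in the probability
    that a block fails. The limit [mu] enters through two statements in probability: [Z] is rarely
    below [(mu - e) n] and rarely above [(mu + e) n]. *)

Section configuration.
Context {R : realType} {I : choiceType}.

Definition upd (x : I -> R) (e : I) (y : R) : I -> R :=
  fun i => if i == e then y else x i.

Definition depends_on {T : Type} (S : set I) (f : (I -> R) -> T) : Prop :=
  forall x y : I -> R, (forall i, S i -> x i = y i) -> f x = f y.

Variable D : set I.

(** Configurations are functions on all of [I], but the sigma-algebra sees only the coordinates in
    [D]. Here [I] will be all pairs of vertices and [D] the genuine edges. *)
Definition cylinder : set (set (I -> R)) :=
  [set C | exists (J : {fset I}) (A : I -> set R),
    [/\ [set` J] `<=` D, forall i, measurable (A i) &
        C = [set x | forall i, i \in J -> A i (x i)]]].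

Definition config := g_sigma_algebraType cylinder.

Lemma setI_closed_cylinder : setI_closed cylinder.
Proof.
move=> _ _ [J1 [A1 [J1D mA1 ->]]] [J2 [A2 [J2D mA2 ->]]].
pose A i := (if i \in J1 then A1 i else setT) `&`
            (if i \in J2 then A2 i else setT).
exists (J1 `|` J2)%fset, A; split.
- by move=> i /=; rewrite in_fsetU => /orP[/J1D|/J2D].
- by move=> i; apply: measurableI; case: ifP.
- apply/seteqP; split=> [x [h1 h2] i|x h].
    by move=> _; split; case: ifPn => // iJ; [exact: h1|exact: h2].
  by split=> i iJ; have := h i; rewrite in_fsetU iJ ?orbT => /(_ isT);
    rewrite /A iJ => -[].
Qed.

Lemma measurable_coord (i : I) : D i ->
  measurable_fun [set: config] (fun x : config => x i).
Proof.
move=> Di _ A mA; rewrite setTI; apply: sub_sigma_algebra.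
exists [fset i]%fset, (fun=> A); split => //.
  by move=> j /=; rewrite inE => /eqP ->.
apply/seteqP; split=> [x Ax j|x /(_ i)]; first by rewrite inE => /eqP ->.
by rewrite inE eqxx => /(_ isT).
Qed.

Lemma measurable_to_config d (T : measurableType d) (h : T -> config) :
  (forall i, D i -> measurable_fun setT (fun t => h t i)) ->
  measurable_fun setT h.
Proof.
move=> mh; apply: (@measurability _ _ T config setT h cylinder) => //.
move=> _ [C [J [A [JD mA ->]] <-]].
rewrite setTI (_ : _ @^-1` _ =
  \bigcap_(i in [set` J]) ((fun t => h t i) @^-1` A i)); last first.
  by apply/seteqP; split => t /= ht i /ht.
apply: fin_bigcap_measurable; first exact: finite_fset.
by move=> i iJ; rewrite -[_ @^-1` _]setTI; apply: mh => //; exact: JD.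
Qed.

Lemma measurable_upd (e : I) :
  measurable_fun setT (fun p : config * R => upd p.1 e p.2 : config).
Proof.
apply: measurable_to_config => i Di; rewrite /upd.
have [_|ie] := eqVneq i e; first exact: measurable_snd.
exact: (measurableT_comp (measurable_coord Di) measurable_fst).
Qed.

End configuration.
Arguments config {R I} D.

Section resampling.
Context {R : realType} {I : choiceType} (D : set I).
Local Notation config := (@config R I D).
Variable gam : probability R R.
Local Open Scope ereal_scope.

(** Under a product law with marginal [gam] at [e], this is a version of the conditional expectation
    of [f] given all coordinates other than [e]. *)
Definition resample (e : I) (f : config -> \bar R) : config -> \bar R :=
  fun x => \int[gam]_y f (upd x e y).

Definition resamples (l : seq I) (f : config -> \bar R) : config -> \bar R :=
  foldr resample f l.

Definition nnmeas (f : config -> \bar R) :=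
  measurable_fun [set: config] f /\ forall x, 0 <= f x.

Lemma measurable_updl (x : config) (e : I) :
  measurable_fun setT (fun y : R => upd x e y : config).
Proof.
apply: measurable_to_config => i Di; rewrite /upd.
by have [_|ie] := eqVneq i e; [exact: measurable_id|exact: measurable_cst].
Qed.

Lemma nnmeas_updl f x e : nnmeas f ->
  measurable_fun setT (fun y : R => f (upd x e y)).
Proof. by move=> [mf _]; exact: (measurableT_comp mf (measurable_updl x e)). Qed.

Lemma nnmeas_resample e f : nnmeas f -> nnmeas (resample e f).
Proof.
move=> [mf f0]; split; last by move=> x; apply: integral_ge0.
pose h := fun p : config * R => f (upd p.1 e p.2).
apply: (@measurable_fun_fubini_tonelli_F _ _ _ _ _ gam h).
- exact: (measurableT_comp mf (measurable_upd e)).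
- by move=> x; exact: f0.
Qed.

Lemma nnmeas_resamples l f : nnmeas f -> nnmeas (resamples l f).
Proof. by move=> nf; elim: l => //= e l; exact: nnmeas_resample. Qed.

Lemma nnmeasM f g : nnmeas f -> nnmeas g -> nnmeas (f \* g).
Proof.
move=> [mf f0] [mg g0]; split; first exact: emeasurable_funM.
by move=> x; exact: mule_ge0.
Qed.

Lemma depends_resample (S : set I) e f : depends_on S f ->
  depends_on (S `\ e) (resample e f).
Proof.
move=> Sf x y xy; apply: eq_integral => v _; apply: Sf => i Si.
by rewrite /upd; case: eqVneq => // ie; apply: xy; split => //; exact/eqP.
Qed.

Lemma depends_resamples (S : set I) l f : depends_on S f ->
  depends_on (S `\` [set` l]) (resamples l f).
Proof.
elim: l => [|e l IH] Sf /=.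
  by move=> x y xy; apply: Sf => i Si; exact: xy.
move=> x y xy; apply: (depends_resample (IH Sf)) => i [[Si il] ie].
by apply: xy; split => //=; rewrite inE => /orP[/eqP//|].
Qed.

Lemma resamples_cst l f : depends_on [set` l] f ->
  forall x y, resamples l f x = resamples l f y.
Proof.
move=> /(@depends_resamples _ l); rewrite setDv => h x y.
by apply: h => i [].
Qed.

Lemma resample_mulr e f g S : nnmeas f -> nnmeas g -> depends_on S g ->
  ~ S e -> resample e (f \* g) = resample e f \* g.
Proof.
move=> nf ng Sg Se; apply/funext => x; rewrite /resample.
have gE y : g (upd x e y) = g x.
  by apply: Sg => i Si; rewrite /upd; case: eqVneq => // ie; rewrite ie in Si.
under eq_integral do rewrite gE.
rewrite ge0_integralZr//; first exact: nnmeas_updl.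
- by move=> y _; case: nf.
- by case: ng.
Qed.

Lemma resamples_mulr l f g S : nnmeas f -> nnmeas g -> depends_on S g ->
  (forall i, i \in l -> ~ S i) -> resamples l (f \* g) = resamples l f \* g.
Proof.
move=> nf ng Sg; elim: l => //= e l IH lS.
rewrite IH; last by move=> i il; apply: lS; rewrite inE il orbT.
rewrite (resample_mulr (S := S))//; first exact: nnmeas_resamples.
by apply: lS; rewrite inE eqxx.
Qed.

Definition relabel (s : I -> I) (x : config) : config := fun i => x (s i).

Lemma resamples_relabel (s : I -> I) l f : injective s ->
  resamples (map s l) (f \o relabel s) = resamples l f \o relabel s.
Proof.
move=> s_inj; elim: l => //= e l ->.
apply/funext => x /=; rewrite /resample; apply: eq_integral => y _ /=.
congr (resamples l f _); apply/funext => i.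
by rewrite /relabel /upd (inj_eq s_inj).
Qed.

Lemma le_resample e f g : nnmeas f -> nnmeas g ->
  (forall x, f x <= g x) -> forall x, resample e f x <= resample e g x.
Proof.
move=> nf ng fg x; apply: ge0_le_integral => //.
- by move=> y _; case: nf.
- exact: nnmeas_updl.
- exact: nnmeas_updl.
Qed.

Lemma resample1 e x : resample e (cst 1) x = 1.
Proof.
rewrite /resample/= integral_cst// mul1e.
exact: probability_setT.
Qed.

Definition decreasing_le1 (f : config -> \bar R) :=
  [/\ nnmeas f, forall x, f x <= 1 &
   forall x y, (forall i, (x i <= y i)%R) -> f y <= f x].

Lemma decreasing_le1_resample e f : decreasing_le1 f ->
  decreasing_le1 (resample e f).
Proof.
move=> [nf f1 fd]; split; first exact: nnmeas_resample.
  move=> x; rewrite -(resample1 e x); exact: le_resample.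
move=> x y xy; rewrite /resample; apply: ge0_le_integral => //.
- by move=> v _; case: nf.
- exact: nnmeas_updl.
- exact: nnmeas_updl.
- by move=> v _; apply: fd => i; rewrite /upd; case: ifP.
Qed.

End resampling.

(** * Association and independence *)

Section association.
Context {R : realType} (gam : probability R R).
Local Open Scope ereal_scope.

(* The truncation level [a] is chosen so that [f - a] and [g - \int g] have the
   same sign everywhere. *)
Lemma association (f g : R -> \bar R) :
  measurable_fun setT f -> measurable_fun setT g ->
  (forall x, 0 <= f x <= 1) -> (forall x, 0 <= g x <= 1) ->
  {homo f : x y / (x <= y)%R >-> y <= x} ->
  {homo g : x y / (x <= y)%R >-> y <= x} ->
  (\int[gam]_x f x) * (\int[gam]_x g x) <= \int[gam]_x (f x * g x).
Proof.
move=> mf mg f01 g01 fd gd.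
have f0 x : 0 <= f x by have /andP[] := f01 x.
have g0 x : 0 <= g x by have /andP[] := g01 x.
set c := \int[gam]_x g x.
have int1 : \int[gam]_x 1 = 1.
  by rewrite integral_cst// mul1e; exact: probability_setT.
have le1 h : measurable_fun setT h -> (forall x, 0 <= h x <= 1) ->
    \int[gam]_x h x <= 1.
  move=> mh h01; rewrite -int1; apply: ge0_le_integral => //.
  - by move=> x _; have /andP[] := h01 x.
  - by move=> x _; have /andP[] := h01 x.
have c0 : 0 <= c by apply: integral_ge0.
have c1 : c <= 1 by exact: le1.
have cfin : c \is a fin_num.
  by rewrite ge0_fin_numE// (le_lt_trans c1)// ltry.
(* Adjoining [1] keeps the infimum finite without deciding whether [g] reaches its mean. *)
pose a := ereal_inf ([set 1] `|` [set f x | x in [set x | c <= g x]]).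
have a0 : 0 <= a.
  by apply: le_ereal_inf_tmp => _ [->//|[x _ <-]].
have a1 : a <= 1 by apply: ereal_inf_lbound; left.
have afin : a \is a fin_num.
  by rewrite ge0_fin_numE// (le_lt_trans a1)// ltry.
(* This is [0 <= (f x - a) * (g x - c)] with the terms moved so that only nonnegative extended reals
   occur. *)
have key x : f x * c + a * g x <= f x * g x + a * c.
  have fxfin : f x \is a fin_num.
    by rewrite ge0_fin_numE// (@le_lt_trans _ _ 1) ?ltry//; case/andP: (f01 x).
  have gxfin : g x \is a fin_num.
    by rewrite ge0_fin_numE// (@le_lt_trans _ _ 1) ?ltry//; case/andP: (g01 x).
  have [cgx|gxc] := leP c (g x).
    have afx : a <= f x by apply: ereal_inf_lbound; right; exists x.
    move: cgx afx.
    rewrite -(fineK cfin) -(fineK afin) -(fineK fxfin) -(fineK gxfin).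
    by rewrite !lee_fin => h1 h2; nra.
  have fxa : f x <= a.
    apply: le_ereal_inf_tmp => _ [->|[y /= cgy <-]].
      by case/andP: (f01 x).
    apply: fd; rewrite leNgt; apply/negP => /ltW/gd xy.
    by move: gxc; rewrite ltNge (le_trans cgy).
  move: (ltW gxc) fxa.
  rewrite -(fineK cfin) -(fineK afin) -(fineK fxfin) -(fineK gxfin).
  by rewrite !lee_fin => h1 h2; nra.
have mfg : measurable_fun setT (fun x => f x * g x) by exact: emeasurable_funM.
have : \int[gam]_x (f x * c + a * g x) <= \int[gam]_x (f x * g x + a * c).
  apply: ge0_le_integral => //.
  - by move=> x _; rewrite adde_ge0// mule_ge0.
  - apply: emeasurable_funD; apply: emeasurable_funM => //.
  - by apply: emeasurable_funD => //.
rewrite ge0_integralD//; last 4 first.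
- by move=> x _; rewrite mule_ge0.
- by apply: emeasurable_funM.
- by move=> x _; rewrite mule_ge0.
- by apply: emeasurable_funM.
rewrite ge0_integralZr// ge0_integralZl// -/c.
rewrite ge0_integralD//; last 2 first.
- by move=> x _; rewrite mule_ge0.
- by move=> x _; rewrite mule_ge0.
have -> : \int[gam]_x (a * c) = a * c.
  rewrite integral_cst//= -[RHS]mule1; congr (_ * _).
  exact: probability_setT.
by rewrite leeD2rE// fin_numM.
Qed.

End association.

(** * Consequences of invariance under resampling: independence, symmetry, Harris inequality *)

Section product_law.
Context {R : realType} {I : choiceType} (D : set I).
Local Notation config := (@config R I D).
Variable gam : probability R R.
Variable Q : probability config R.
Local Open Scope ereal_scope.
Hypothesis resampleQ : forall e f, D e -> nnmeas f ->
  \int[Q]_x f x = \int[Q]_x resample gam e f x.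

Lemma integral_resamples (l : seq I) f : {in l, forall e, D e} -> nnmeas f ->
  \int[Q]_x f x = \int[Q]_x resamples gam l f x.
Proof.
move=> lD nf; elim: l lD => //= e l IH lD.
have De : D e by apply: lD; rewrite inE eqxx.
rewrite -(resampleQ De (nnmeas_resamples gam l nf)).
apply: IH => i il. apply: lD. by rewrite inE il orbT.
Qed.

(** Once all the coordinates that [f] depends on are integrated out, a constant remains:
    expectations of local functions become finite iterated integrals that no longer mention [Q]. *)
Lemma integral_resamples_cst (l : seq I) f x : {in l, forall e, D e} -> nnmeas f ->
  depends_on [set` l] f -> \int[Q]_x f x = resamples gam l f x.
Proof.
move=> lD nf lf; rewrite (integral_resamples lD)//.
under eq_integral do rewrite (resamples_cst gam lf _ x).
have [_ h0] := @nnmeas_resamples _ _ _ gam l _ nf.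
rewrite integral_cst//= -[RHS]mule1; congr (_ * _).
exact: probability_setT.
Qed.

(** Resampling along [l] turns [f] into a constant and passes through [g]. Only [l] has to be
    finite; [S] may be infinite, such as all edges from some level on. *)
Lemma integral_indep (l : seq I) f g S : {in l, forall e, D e} -> nnmeas f -> nnmeas g ->
  depends_on [set` l] f -> depends_on S g -> (forall i, i \in l -> ~ S i) ->
  \int[Q]_x (f x * g x) = (\int[Q]_x f x) * (\int[Q]_x g x).
Proof.
move=> lD nf ng lf Sg lS.
rewrite (integral_resamples lD); last exact: nnmeasM.
rewrite (resamples_mulr gam nf ng Sg)//=.
under eq_integral do rewrite (resamples_cst gam lf _ (fun=> 0%R)).
rewrite ge0_integralZl//; first by rewrite (integral_resamples_cst (fun=> 0%R) lD nf lf).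
- by case: ng.
- by move=> x _; case: ng.
- by case: (@nnmeas_resamples _ _ _ gam l _ nf).
Qed.

(** Both sides equal the same iterated integral, because every coordinate is resampled from the same
    [gam]. Translation and reflection invariance of the environment are instances. *)
Lemma integral_relabel s (l : seq I) f : injective s -> {in l, forall e, D e} ->
  {in l, forall e, D (s e)} -> nnmeas f -> nnmeas (f \o relabel s) ->
  depends_on [set` l] f -> \int[Q]_x f (relabel s x) = \int[Q]_x f x.
Proof.
move=> s_inj lD slD nf nfs lf.
rewrite (integral_resamples_cst (fun=> 0%R) lD nf lf).
have -> : \int[Q]_x f (relabel s x) =
    resamples gam (map s l) (f \o relabel s) (fun=> 0%R).
  apply: (integral_resamples_cst (f := f \o relabel s)) => //.
    by move=> _ /mapP[e el ->]; exact: slD.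
  move=> x y xy; apply: lf => i /= il; apply: xy.
  by rewrite /= map_f.
by rewrite resamples_relabel//=; exact: resamples_cst.
Qed.

(** Induction on the coordinates. Resampling the inner ones keeps both functions decreasing in [e],
    so the one-variable inequality applies to them; the induction hypothesis is then integrated over
    [e]. *)
Lemma harris_resamples (l : seq I) (f g : config -> \bar R) x :
  decreasing_le1 f -> decreasing_le1 g ->
  resamples gam l f x * resamples gam l g x <= resamples gam l (f \* g) x.
Proof.
move=> df dg; elim: l x => //= e l IH x.
have dl (h : config -> \bar R) : decreasing_le1 h -> decreasing_le1 (resamples gam l h).
  by move=> dh; elim: (l) => //= i k; exact: decreasing_le1_resample.
have [[nf f1 fd] [ng g1 gd]] := (dl _ df, dl _ dg).
apply: (@le_trans _ _ (resample gam e (resamples gam l f \* resamples gam l g) x)).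
  apply: association.
  - exact: nnmeas_updl.
  - exact: nnmeas_updl.
  - by move=> y; rewrite f1 andbT; case: nf.
  - by move=> y; rewrite g1 andbT; case: ng.
  - by move=> y z yz; apply: fd => i; rewrite /upd; case: ifP.
  - by move=> y z yz; apply: gd => i; rewrite /upd; case: ifP.
apply: le_resample => //; first exact: nnmeasM.
by apply: nnmeas_resamples; apply: nnmeasM; [case: df|case: dg].
Qed.

Lemma harris (l : seq I) f g : {in l, forall e, D e} ->
  decreasing_le1 f -> decreasing_le1 g ->
  depends_on [set` l] f -> depends_on [set` l] g ->
  (\int[Q]_x f x) * (\int[Q]_x g x) <= \int[Q]_x (f x * g x).
Proof.
move=> lD df dg lf lg; have [[nf _ _] [ng _ _]] := (df, dg).
rewrite (integral_resamples_cst (fun=> 0%R) lD nf lf).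
rewrite (integral_resamples_cst (fun=> 0%R) lD ng lg).
have -> : \int[Q]_x (f x * g x) = resamples gam l (f \* g) (fun=> 0%R).
  apply: (integral_resamples_cst (f := f \* g)) => //; first exact: nnmeasM.
  by move=> x y xy /=; rewrite (lf _ _ xy) (lg _ _ xy).
exact: harris_resamples.
Qed.

End product_law.

(** * The joint law and Gaussian estimates *)

Section law_of_family.
Context {R : realType} d (Omega : measurableType d) (P : probability Omega R).
Context (I : choiceType) (D : set I) (X : I -> {RV P >-> R}).
Context (gam : probability R R).
Hypothesis X_indep : mutually_independent D X.
Hypothesis X_law : forall e, D e -> has_law (X e) gam.
Local Notation config := (@config R I D).
Local Open Scope ereal_scope.

Definition joint (w : Omega) : config := fun i => X i w.

Lemma measurable_joint : measurable_fun setT joint.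
Proof. by apply: measurable_to_config => i _; exact: measurable_funPT. Qed.

HB.instance Definition _ := isMeasurableFun.Build _ _ _ _ joint measurable_joint.

Definition joint_law : probability config R := distribution P joint.

Definition updp (e : I) (p : config * R) : config := upd p.1 e p.2.

HB.instance Definition _ e :=
  isMeasurableFun.Build _ _ _ _ (updp e) (measurable_upd e).

(** Cylinders form a generating pi-system, and on a cylinder the claim is that the factor at [e]
    splits off: here independence and the law of [X e] enter. *)
Lemma joint_law_upd e (A : set config) : D e -> measurable A ->
  joint_law A = pushforward (joint_law \x gam) (updp e) A.
Proof.
move=> De mA.
apply: (@measure_unique _ R config (cylinder D) (fun=> setT)) => //.
- exact: setI_closed_cylinder.
- move=> _; exists fset0, (fun=> setT); split => //.
  by apply/seteqP; split => // x _ i; rewrite inE.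
- by rewrite bigcup_const.
- move=> C [J [B [JD mB ->]]].
  pose B' i := if i \in J then B i else setT.
  have mB' i : measurable (B' i) by rewrite /B'; case: ifP.
  (* With [B'] trivial outside [J], the cylinder factors into its part over [K] and [B' e], whether
     or not [J] contains [e]. *)
  pose K := (J `\ e)%fset.
  have eK : e \notin K by rewrite !inE eqxx.
  have KD : [set` K] `<=` D by move=> i /=; rewrite !inE => /andP[_ /JD].
  pose C' : set config := [set x | forall i, i \in K -> B' i (x i)].
  have mC' : measurable C' by apply: sub_sigma_algebra; exists K, B'.
  have E : updp e @^-1` [set x | forall i, i \in J -> B i (x i)] = C' `*` B' e.
    apply/seteqP; split => -[x y] /= h.
      split=> [i|]; last first.
        by rewrite /B'; case: ifPn => // /h; rewrite /updp /upd eqxx.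
      rewrite !inE => /andP[ie iJ]; have := h i iJ.
      by rewrite /B' iJ /updp /upd (negbTE ie).
    move=> i iJ; rewrite /updp /upd /=; have [ie|ie] := eqVneq i e.
      by case: h => _; rewrite /B' -ie iJ.
    by case: h => /(_ i); rewrite /B' !inE ie iJ => /(_ isT).
  rewrite /= /pushforward E.
  have Lg : P (X e @^-1` B' e) = gam (B' e) by exact: (X_law De (mB' e)).
  transitivity (joint_law C' * P (X e @^-1` B' e)); last first.
    rewrite [RHS](product_measure1E joint_law gam)//.
    by congr (_ * _).
  have JE (L : {fset I}) : joint_law [set x | forall i, i \in L -> B' i (x i)] =
      P (\bigcap_(i in [set` L]) (X i @^-1` B' i)).
    by congr (P _); apply/seteqP; split.
  have -> : [set x : config | forall i, i \in J -> B i (x i)] =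
      [set x | forall i, i \in (e |` K)%fset -> B' i (x i)].
    apply/seteqP; split=> x /= h i; first by move=> _; rewrite /B'; case: ifP => // /h.
    by move=> iJ; have := h i; rewrite !inE iJ andbT orbN /B' iJ; apply.
  rewrite /C' !JE !X_indep//; last first.
    by move=> i /=; rewrite !inE => /orP[/eqP->|/andP[_ /JD]].
  by rewrite muleC big_fsetU1.
- by move=> _; apply: (le_lt_trans (probability_le1 _ _)); rewrite ?ltry.
Qed.

Lemma joint_law_resample e (f : config -> \bar R) : D e -> nnmeas f ->
  \int[joint_law]_x f x = \int[joint_law]_x resample gam e f x.
Proof.
move=> De [mf f0].
rewrite (@eq_measure_integral _ _ _ setT (pushforward (joint_law \x gam) (updp e))).
  rewrite ge0_integral_pushforward//=.
  rewrite preimage_setT.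
  apply: (fubini_tonelli1 (m1 := joint_law) (m2 := gam) (f \o updp e)) => //.
    exact: (measurableT_comp mf (measurable_upd e)).
  by move=> x; exact: f0.
by move=> A mA _; exact: joint_law_upd.
Qed.

End law_of_family.

(** * Gaussian integrals and tail bounds *)

Section gaussian.
Context {R : realType}.
Local Open Scope ereal_scope.
Notation mu := (@lebesgue_measure R).

(** The Radon-Nikodym derivative agrees with [normal_pdf] almost everywhere, since both integrate to
    [normal_prob] over every measurable set. *)
Lemma ge0_integral_normal_prob (m s : R) (f : R -> \bar R) :
  measurable_fun setT f -> (forall x, 0 <= f x) ->
  \int[normal_prob m s]_x f x = \int[mu]_x (f x * (normal_pdf m s x)%:E).
Proof.
move=> mf f0; have dom := @normal_prob_dominates R m s.
pose g := Radon_Nikodym_SigmaFinite.f (normal_prob m s) mu.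
rewrite -(Radon_Nikodym_SigmaFinite.change_of_variables dom)//.
have gI := Radon_Nikodym_SigmaFinite.f_integrable dom.
have mpdf : measurable_fun setT (fun x => (normal_pdf m s x)%:E).
  by apply/measurable_EFinP; exact: measurable_normal_pdf.
have mg : measurable_fun setT g by exact: measurable_int gI.
apply: ae_eq_integral => //; [exact: emeasurable_funM..|].
apply: ae_eqe_mul2l; apply: integral_ae_eq => // A _ mA.
by rewrite -Radon_Nikodym_SigmaFinite.f_integral.
Qed.

Lemma normal_mgf (a : R) :
  \int[normal_prob 0 1]_x (expR (a * x))%:E = (expR (a ^+ 2 / 2))%:E.
Proof.
rewrite ge0_integral_normal_prob; last 2 first.
- apply/measurable_EFinP; apply: measurableT_comp => //.
- by move=> x; rewrite lee_fin expR_ge0.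
transitivity (\int[mu]_x ((expR (a ^+ 2 / 2))%:E * (normal_pdf a 1 x)%:E)).
  apply: eq_integral => x _; rewrite -!EFinM; congr EFin.
  rewrite !normal_pdfE ?oner_eq0// /normal_fun.
  rewrite [LHS]mulrCA [RHS]mulrCA -!expRD; congr (_ * expR _)%R.
  by rewrite expr1n mulr2n; field.
rewrite ge0_integralZl//.
- by rewrite integral_normal_pdf mule1.
- by apply/measurable_EFinP; exact: measurable_normal_pdf.
- by move=> x _; rewrite lee_fin normal_pdf_ge0.
Qed.

(** Exponential Chebyshev with parameter 1 instead of the optimal [t]: a linear exponent already
    beats the polynomial number of edges in the later union bound. *)
Lemma normal_prob_le (t : R) :
  normal_prob 0 1 [set x : R | x <= - t]%R <= (expR (2^-1 - t))%:E.
Proof.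
have mS : measurable [set x : R | x <= - t]%R.
  by rewrite -set_itvNyc; exact: measurable_itv.
have -> : (expR (2^-1 - t))%:E =
    (expR (- t))%:E * \int[normal_prob 0 1]_x (expR (- 1 * x))%:E.
  by rewrite normal_mgf -EFinM -expRD; congr (expR _)%:E; field.
have mexp : measurable_fun setT (fun x : R => (expR (- 1 * x))%:E).
  by apply/measurable_EFinP; apply: measurableT_comp => //; exact: measurable_funM.
rewrite -ge0_integralZl//.
set S := [set x : R | _]%R in mS *.
have -> : normal_prob 0 1 S = \int[normal_prob 0 1]_x (\1_S x)%:E.
  by rewrite integral_indic// setIT.
apply: ge0_le_integral => //.
- by apply/measurable_EFinP; exact: measurable_indic.
- exact: emeasurable_funM.
move=> x _; rewrite -EFinM lee_fin -expRD indicE.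
case: (boolP (_ \in _)) => xt; last exact: expR_ge0.
by rewrite -[leLHS]expR0 ler_expR; move: xt; rewrite inE /S /=; lra.
Qed.

(** On the unit interval [[- t - 1, - t]] one has [x ^+ 2 <= 4 * t ^+ 2], so the density is at least
    its peak times [expR (- 2 * t ^+ 2)]. As [1 <= t], the peak can be absorbed in the exponent. *)
Lemma normal_prob_ge : exists2 C : R, (0 < C)%R & forall t : R, (1 <= t)%R ->
  (expR (- C * t ^+ 2))%:E <= normal_prob 0 1 [set x : R | x <= - t]%R.
Proof.
have p0 : (0 < normal_peak 1 :> R)%R by rewrite normal_peak_gt0// oner_eq0.
exists (2 + `|ln (normal_peak 1 : R)|)%R => [|t t1]; first by rewrite ltr_wpDr.
have mS : measurable [set x : R | x <= - t]%R.
  by rewrite -set_itvNyc; exact: measurable_itv.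
have mI : measurable `[(- t - 1)%R, (- t)%R] by exact: measurable_itv.
have mpdf : measurable_fun setT (fun x : R => (normal_pdf 0 1 x)%:E).
  by apply/measurable_EFinP; exact: measurable_normal_pdf.
apply: (@le_trans _ _ (normal_prob 0 1 `[(- t - 1)%R, (- t)%R])); last first.
  apply: le_measure; rewrite ?inE//.
  by move=> x /=; rewrite in_itv/= => /andP[].
have -> : (expR (- (2 + `|ln (normal_peak 1 : R)|) * t ^+ 2))%:E =
    \int[mu]_(x in `[(- t - 1)%R, (- t)%R])
      (cst (expR (- (2 + `|ln (normal_peak 1 : R)|) * t ^+ 2))%:E x).
  rewrite integral_cst//= lebesgue_measure_itv/= lte_fin ltrBlDr ltrDl ltr01.
  by rewrite -EFinB -EFinM; congr EFin; ring.
apply: ge0_le_integral => //.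
- by move=> x _; rewrite lee_fin expR_ge0.
- exact: measurable_funTS.
move=> x /=; rewrite in_itv/= => /andP[x1 x2]; rewrite lee_fin.
rewrite normal_pdfE ?oner_eq0// /normal_fun -[normal_peak 1]lnK ?posrE// -expRD.
rewrite ler_expR subr0 expr1n lnK ?posrE//.
have h : (- `|ln (normal_peak 1 : R)| * t ^+ 2 <= ln (normal_peak 1 : R))%R.
  have h1 : (- `|ln (normal_peak 1 : R)| <= ln (normal_peak 1 : R))%R.
    by rewrite lerNl -normrN ler_norm.
  have t2 : (0 <= t ^+ 2 - 1)%R by nra.
  have := mulr_ge0 (normr_ge0 (ln (normal_peak 1 : R))) t2.
  by rewrite mulrBr mulr1 mulNr; lra.
have hx : (x ^+ 2 <= 4 * t ^+ 2)%R. 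
  have y1 : (0 <= (t + 1 + x) * (t + 1 - x))%R by apply: mulr_ge0; lra.
  have y2 : (0 <= (t - 1) * (3 * t + 1))%R by apply: mulr_ge0; lra.
  by nra.
have aux (a p u v : R) :
    (a <= p -> v <= 4 * u -> a - 2 * u <= p + - v / 2)%R by lra.
rewrite opprD mulrDl addrC mulNr (mulNr 2).
by apply: aux => //; rewrite -mulNr.
Qed.

End gaussian.

Section standard_normal.
Context {R : realType}.

(* [normal_prob] is a measure for the Borel sigma-algebra carried by
   [measurableTypeR R]; the random variables take their values in [R] with its
   default display. *)
Definition borel_id (x : measurableTypeR R) : R := x.

Lemma measurable_borel_id : measurable_fun setT borel_id.
Proof. by move=> _ A mA; rewrite setTI. Qed.

HB.instance Definition _ :=
  isMeasurableFun.Build _ _ _ _ borel_id measurable_borel_id.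

Definition std_normal : probability R R :=
  distribution [the probability (measurableTypeR R) R of @normal_prob R 0 1]
    borel_id.

Lemma std_normalE (A : set R) : std_normal A = normal_prob 0 1 A.
Proof. by []. Qed.

Lemma std_normal_mgf (a : R) :
  (\int[std_normal]_x (expR (a * x))%:E = (expR (a ^+ 2 / 2))%:E)%E.
Proof.
rewrite -normal_mgf /std_normal ge0_integral_distribution//.
by apply/measurable_EFinP; exact: measurableT_comp.
Qed.

End standard_normal.

(** * Lattice paths *)

Local Notation vertex := Defs.point.

Section lattice_paths.
Context {R : realType}.
Implicit Types (x y : int) (k n : nat) (b : bool) (s : seq bool).

Definition step x b : int := if b then x + 1 else x - 1.

Definition edge x k b : vertex * vertex := ((x, k), (step x b, k.+1)).

(* A path is encoded by its starting vertex [(x, k)] and the sequence of its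
   steps, [true] being a step to the right. *)
Fixpoint weight x k s (w : vertex * vertex -> R) : R :=
  if s is b :: s' then w (edge x k b) + weight (step x b) k.+1 s' w else 0.

Definition endpoint x s : int := foldl step x s.

Fixpoint vertices x k s : seq vertex :=
  if s is b :: s' then (step x b, k.+1) :: vertices (step x b) k.+1 s' else [::].

Lemma size_vertices x k s : size (vertices x k s) = size s.
Proof. by elim: s x k => //= b s IH x k; rewrite IH. Qed.

Lemma sum_vertices x k s w :
  \sum_(e <- zip ((x, k) :: vertices x k s) (vertices x k s)) w e =
  weight x k s w.
Proof.
elim: s x k => [|b s IH] x k /=; first by rewrite big_nil.
by rewrite big_cons -IH.
Qed.

Lemma Xi_step x k b : (x, k) \in Xi -> (step x b, k.+1) \in Xi.
Proof. by rewrite /in_mem /= /Xi /step /=; case: b; lia. Qed.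

Lemma E_edge x k b : E (edge x k b) <-> (x, k) \in Xi.
Proof.
rewrite /E /= /is_edge /= eqxx andbT; split => [/andP[]//|->/=].
by rewrite /step; case: b; rewrite eqxx ?orbT.
Qed.

Lemma path_vertices x k s : (x, k) \in Xi ->
  path is_edge (x, k) (vertices x k s).
Proof.
elim: s x k => //= b s IH x k xk; rewrite IH ?Xi_step// andbT.
exact/(E_edge x k b).
Qed.

Lemma path_is_edgeP x k (g : seq vertex) : path is_edge (x, k) g ->
  exists2 s, size s = size g & g = vertices x k s.
Proof.
elim: g x k => [|[y j] g IH] x k /=; first by exists [::].
move=> /andP[/and3P[/= xk yx /eqP jk] /IH[s ss gs]].
exists ((y == x + 1) :: s); rewrite /= ?ss// gs.
suff -> : step x (y == x + 1) = y by rewrite jk.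
by rewrite /step; case: eqP yx => [//|_ /= /eqP].
Qed.

Lemma weight_cat x k s1 s2 w : weight x k (s1 ++ s2) w =
  weight x k s1 w + weight (endpoint x s1) (k + size s1) s2 w.
Proof.
elim: s1 x k => [|b s1 IH] x k /=; first by rewrite add0r addn0.
by rewrite IH addrA addnS addSn.
Qed.

Lemma endpointE x s : endpoint x s = x + (2 * count id s)%N%:Z - (size s)%:Z.
Proof.
elim: s x => [|b s IH] x /=; first by rewrite subr0 addr0.
by rewrite IH /step; case: b; lia.
Qed.

Lemma endpoint_bound x s : `|endpoint x s - x| <= (size s)%:Z.
Proof. by rewrite endpointE; have := count_size id s; lia. Qed.

Lemma Xi_endpoint x k s : (x, k) \in Xi -> (endpoint x s, (k + size s)%N) \in Xi.
Proof.
elim: s x k => [|b s IH] x k xk /=; first by rewrite addn0.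
by rewrite addnS -addSn; apply: IH; exact: Xi_step.
Qed.

Definition bitseqs n : seq (seq bool) := map val (enum {: n.-tuple bool}).

Lemma mem_bitseqs n s : (s \in bitseqs n) = (size s == n).
Proof.
apply/mapP/eqP => [[t _ ->]|<-]; first exact: size_tuple.
by exists (in_tuple s); rewrite ?mem_enum.
Qed.

Lemma uniq_bitseqs n : uniq (bitseqs n).
Proof. by rewrite map_inj_uniq ?enum_uniq//; exact: val_inj. Qed.

Lemma ZleP w n (t : R) : Z w n <= t <->
  forall s, size s = n -> weight 0 0%N s w <= t.
Proof.
set A := [set \sum_(e <- edges_of g) w e | g in aleph n].
have inA s : size s = n -> A (weight 0 0%N s w).
  move=> sn; exists (vertices 0 0%N s).
    by split; [rewrite size_vertices|exact: path_vertices].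
  by rewrite /edges_of sum_vertices.
(* A real [sup] is a supremum only for a nonempty bounded set; this crude bound supplies
   boundedness. *)
have Aub : has_ubound A.
  exists (\sum_(s <- bitseqs n) `|weight 0 0%N s w|) => _ [g [gn gp] <-].
  have [s sg gs] := path_is_edgeP gp.
  rewrite /edges_of /origin gs sum_vertices (bigD1_seq s) ?uniq_bitseqs//=.
    by rewrite (le_trans (ler_norm _))// lerDl sumr_ge0.
  by rewrite mem_bitseqs sg gn.
split=> [Zt s sn|h].
  by apply: le_trans Zt; apply: ub_le_sup => //; exact: inA.
apply: ge_sup.
  by exists (weight 0 0%N (nseq n true) w); apply: inA; rewrite size_nseq.
move=> _ [g [gn gp] <-]; have [s sg gs] := path_is_edgeP gp.
by rewrite /edges_of /origin gs sum_vertices; apply: h; rewrite sg.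
Qed.

(** The lattice symmetry carrying the origin to [(y, k)], composed with a reflection when [r] is
    false. *)
Definition place (r : bool) y k (u : vertex) : vertex :=
  (if r then y + u.1 else y - u.1, (k + u.2)%N).

Definition place_edge r y k (e : vertex * vertex) : vertex * vertex :=
  (place r y k e.1, place r y k e.2).

Lemma place_edge_inj r y k : injective (place_edge r y k).
Proof.
move=> [[x1 k1] [x2 k2]] [[x3 k3] [x4 k4]].
by rewrite /place_edge /place /=; case: r => -[] *; congr ((_, _), (_, _)); lia.
Qed.

Lemma weight_place r y k x j s w :
  weight x j s (fun e => w (place_edge r y k e)) =
  weight (place r y k (x, j)).1 (k + j) (map (eqb r) s) w.
Proof.
elim: s x j => //= b s IH x j; rewrite IH -addnS; congr (w _ + weight _ _ _ _).
- rewrite /place_edge /edge /place /= addnS; congr (_, (_, _)).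
  by rewrite /step; case: r {IH}; case: b => /=; lia.
- by rewrite /place/= /step; case: r {IH}; case: b => /=; lia.
Qed.

Definition box x (m k h : nat) : seq (vertex * vertex) :=
  [seq e <- [seq edge p.1 p.2 b |
      p <- [seq (x - m%:Z + i%:Z, j) | i <- iota 0 (2 * m).+1, j <- iota k h],
      b <- [:: true; false]]
   | e.1 \in Xi].

Lemma mem_box x m k h y j b : (edge y j b \in box x m k h) =
  [&& `|y - x| <= m%:Z, (k <= j < k + h)%N & (y, j) \in Xi].
Proof.
rewrite mem_filter andbC !andbA; congr (_ && _); rewrite -andbA.
apply/allpairsP/andP => [[[p b'] [pP _ eP]]|[yx jh]].
  have [[i j'] [im jh pE]] := allpairsP pP.
  move: eP pE im jh; rewrite !mem_iota [(i, j').1]/= [(i, j').2]/=.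
  rewrite [(p, b').1]/= => -[-> -> _ _] ->; rewrite [(_, _).1]/= [(_, _).2]/=.
  by lia.
exists ((y, j), b); split=> //; last by case: (b); rewrite !inE.
rewrite [(_, _).1]/=; apply/allpairsP.
exists (`|(y - x + m%:Z)%R|%N, j); split; rewrite ?[(_, _).1]/= ?[(_, _).2]/=.
- by rewrite mem_iota; lia.
- by rewrite mem_iota.
- by congr (_, _); lia.
Qed.

Lemma box_edge x m k h e : e \in box x m k h -> exists y j b, e = edge y j b.
Proof.
rewrite mem_filter => /andP[_ /allpairsP[[p b] [_ _ ->]]].
by exists p.1, p.2, b.
Qed.

Lemma box_E x m k h : {in box x m k h, forall e, E e}.
Proof.
move=> e eb; have [y [j [b ejb]]] := box_edge eb.
by move: eb; rewrite ejb mem_box => /and3P[_ _ ?]; apply/E_edge.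
Qed.

Lemma box_subset x m k h x' m' k' h' :
  `|x - x'| + m%:Z <= m'%:Z -> (k' <= k)%N -> (k + h <= k' + h')%N ->
  {subset box x m k h <= box x' m' k' h'}.
Proof.
move=> xx kk hh e eb; have [y [j [b ejb]]] := box_edge eb.
move: eb; rewrite ejb !mem_box => /and3P[? ? ->]; rewrite andbT.
by apply/andP; split; lia.
Qed.

Lemma depends_weight x k s : (x, k) \in Xi ->
  depends_on [set` box x (size s) k (size s)] (weight x k s).
Proof.
elim: s x k => //= b s IH x k xk w w' ww; congr (_ + _).
  by apply: ww; rewrite /= mem_box xk; lia.
apply: IH; first exact: Xi_step.
by move=> e /= eb; apply: ww; apply: box_subset eb; rewrite /step; case: b; lia.
Qed.

End lattice_paths.

(** * Exponential moments and stuck layers *)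

Lemma le_of_eq d (T : porderType d) (x y : T) : x = y -> (x <= y)%O.
Proof. by move=> ->. Qed.

Section environment.
Context {R : realType}.
Local Notation conf := (@config R (vertex * vertex)%type E).
Local Notation gam := (@std_normal R).
Context (Q : probability conf R).
Hypothesis resampleQ : forall e (f : conf -> \bar R), E e -> nnmeas f ->
  (\int[Q]_x f x = \int[Q]_x resample gam e f x)%E.
Implicit Types (x y : int) (k n N : nat) (b r : bool) (s : seq bool).

Lemma nnmeas_EFin (f : conf -> R) : measurable_fun setT f ->
  (forall w, 0 <= f w) -> nnmeas (fun w => (f w)%:E : \bar R).
Proof. by move=> mf f0; split=> [|w]; [exact/measurable_EFinP|rewrite lee_fin]. Qed.

Lemma nnmeas_indic (A : set conf) : measurable A ->
  nnmeas (fun w => (\1_A w)%:E : \bar R).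
Proof. by move=> mA; apply: nnmeas_EFin => //; exact: measurable_indic. Qed.

Lemma integral1E (A : set conf) : measurable A ->
  (\int[Q]_w (\1_A w)%:E = Q A)%E.
Proof. by move=> mA; rewrite integral_indic// setIT. Qed.

Lemma measurable_sum_coord (l : seq (vertex * vertex))
    (a : vertex * vertex -> R) : {in l, forall e, E e} ->
  measurable_fun setT (fun w : conf => \sum_(e <- l) a e * w e).
Proof.
elim: l => [|e l IH] lE.
  by apply: (eq_measurable_fun (fun _ : conf => 0 : R)) => // w _; rewrite big_nil.
apply: (eq_measurable_fun (fun w : conf =>
  a e * w e + \sum_(e <- l) a e * w e)) => [w _|]; first by rewrite big_cons.
apply: measurable_funD.
  apply: measurable_funM => //; apply: measurable_coord.
  by apply: lE; rewrite inE eqxx.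
by apply: IH => i il; apply: lE; rewrite inE il orbT.
Qed.

Lemma measurable_expR_sum (l : seq (vertex * vertex))
    (a : vertex * vertex -> R) : {in l, forall e, E e} ->
  measurable_fun setT (fun w : conf => expR (\sum_(e <- l) a e * w e)).
Proof. by move=> lE; apply: measurableT_comp => //; exact: measurable_sum_coord. Qed.

Lemma integral_expR_sum (l : seq (vertex * vertex))
    (a : vertex * vertex -> R) : {in l, forall e, E e} -> uniq l ->
  (\int[Q]_w (expR (\sum_(e <- l) a e * w e))%:E =
   (expR (\sum_(e <- l) a e ^+ 2 / 2))%:E)%E.
Proof.
elim: l => [|e l IH] lE /=.
  move=> _; under eq_integral do rewrite big_nil expR0.
  by rewrite big_nil expR0 integral_cst//= mul1e; exact: probability_setT.
move=> /andP[el ul].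
have Ee : E e by apply: lE; rewrite inE eqxx.
have lE' : {in l, forall e, E e}.
  by move=> i il; apply: lE; rewrite inE il orbT.
pose f := fun w : conf => (expR (a e * w e))%:E.
pose g := fun w : conf => (expR (\sum_(e <- l) a e * w e))%:E.
have nf : nnmeas f.
  apply: nnmeas_EFin => [|w]; last exact: expR_ge0.
  apply: measurableT_comp => //; apply: measurable_funM => //.
  exact: measurable_coord.
have ng : nnmeas g.
  by apply: nnmeas_EFin => [|w]; [exact: measurable_expR_sum|exact: expR_ge0].
transitivity (\int[Q]_w (f w * g w))%E.
  by apply: eq_integral => w _; rewrite big_cons expRD EFinM.
rewrite (integral_indep resampleQ (l := [:: e]) (S := [set` l]))//.
- rewrite IH// (resampleQ Ee nf) big_cons expRD EFinM; congr (_ * _)%E.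
  under eq_integral => w _.
    rewrite /resample /f; under eq_integral do rewrite /upd eqxx.
    rewrite std_normal_mgf; over.
  rewrite integral_cst//= -[RHS]mule1; congr (_ * _)%E.
  exact: probability_setT.
- by move=> i; rewrite inE => /eqP ->.
- by move=> w w' ww'; rewrite /f ww'//= inE.
- move=> w w' ww'; congr (expR _)%:E; apply: eq_big_seq => i il.
  by rewrite ww'.
- by move=> i; rewrite inE => /eqP -> /=; apply/negP.
Qed.

(** The list may repeat edges. The variance is the sum of the squared multiplicities over distinct
    edges, which is the sum of the multiplicities over the list itself. *)
Lemma integral_expR_multisum (l : seq (vertex * vertex)) (a : R) :
  {in l, forall e, E e} ->
  (\int[Q]_w (expR (a * \sum_(e <- l) w e))%:E =
   (expR (a ^+ 2 / 2 * \sum_(e <- l) (count_mem e l)%:R))%:E)%E.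
Proof.
move=> lE.
have sumE (F : vertex * vertex -> R) :
    \sum_(e <- l) F e = \sum_(e <- undup l) (count_mem e l)%:R * F e.
  rewrite -(big_undup_iterop_count _ l xpredT F); apply: eq_bigr => e _.
  by rewrite Monoid.iteropE iter_addr_0 mulr_natl.
transitivity (\int[Q]_w (expR (\sum_(e <- undup l)
    (a * (count_mem e l)%:R) * w e))%:E)%E.
  apply: eq_integral => w _; rewrite sumE mulr_sumr.
  by under eq_bigr do rewrite mulrA.
rewrite integral_expR_sum ?undup_uniq//; last first.
  by move=> e; rewrite mem_undup; exact: lE.
rewrite sumE mulr_sumr; congr (expR _)%:E; apply: eq_bigr => e _.
by rewrite exprMn; ring.
Qed.

Fixpoint path_edges x k s : seq (vertex * vertex) :=
  if s is b :: s' then edge x k b :: path_edges (step x b) k.+1 s' else [::].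

Lemma weightE x k s (w : conf) :
  weight x k s w = \sum_(e <- path_edges x k s) w e.
Proof.
by elim: s x k => [|b s IH] x k /=; rewrite ?big_nil// big_cons IH.
Qed.

Lemma path_edges_E x k s : (x, k) \in Xi -> {in path_edges x k s, forall e, E e}.
Proof.
elim: s x k => //= b s IH x k xk e; rewrite inE => /orP[/eqP ->|].
  exact/E_edge.
by apply: IH; exact: Xi_step.
Qed.

Lemma path_edges_level x k s e : e \in path_edges x k s -> (k <= e.1.2)%N.
Proof.
elim: s x k => //= b s IH x k; rewrite inE => /orP[/eqP ->//|/IH].
exact: ltnW.
Qed.

Lemma path_edges_uniq x k s : uniq (path_edges x k s).
Proof.
elim: s x k => //= b s IH x k; rewrite IH andbT.
by apply/negP => /path_edges_level /=; rewrite ltnn.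
Qed.

Lemma size_path_edges x k s : size (path_edges x k s) = size s.
Proof. by elim: s x k => //= b s IH x k; rewrite IH. Qed.

Lemma measurable_weight x k s : (x, k) \in Xi ->
  measurable_fun setT (weight x k s : conf -> R).
Proof.
move=> xk; have := @measurable_sum_coord (path_edges x k s) (fun=> 1).
move=> /(_ (path_edges_E xk)); congr measurable_fun.
by apply/funext => w; rewrite weightE; under eq_bigr do rewrite mul1r.
Qed.

Lemma integral_expR_weight x k s (a : R) : (x, k) \in Xi ->
  (\int[Q]_w (expR (a * weight x k s w))%:E =
   (expR (a ^+ 2 / 2 * (size s)%:R))%:E)%E.
Proof.
move=> xk; under eq_integral do rewrite weightE.
rewrite integral_expR_multisum; last exact: path_edges_E.
congr (expR (_ * _))%:E; rewrite (eq_big_seq (fun=> 1)).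
  by rewrite big_const_seq count_predT size_path_edges iter_addr_0.
by move=> e es /=; rewrite count_uniq_mem ?path_edges_uniq// es.
Qed.

(** Both inequalities are weak, so every path is [toward] in at least one direction; being stuck in
    both directions therefore constrains all paths. *)
Definition toward r y s : bool :=
  if r then y <= endpoint y s else endpoint y s <= y.

Definition stuck r N y k (t : R) : set conf :=
  [set w | all (fun s => toward r y s ==> (weight y k s w < t)) (bitseqs N)].

Lemma stuckP r N y k (t : R) w : stuck r N y k t w <->
  forall s, size s = N -> toward r y s -> weight y k s w < t.
Proof.
split=> [/allP h s sN st|h].
  by have := h s; rewrite mem_bitseqs sN eqxx st => /(_ isT).
by apply/allP => s; rewrite mem_bitseqs => /eqP sN; apply/implyP; exact: h.
Qed.

Lemma measurable_all_bits (p : seq bool -> conf -> bool) (L : seq (seq bool)) :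
  (forall s, s \in L -> measurable [set w | p s w]) ->
  measurable [set w | all (p^~ w) L].
Proof.
elim: L => [|s L IH] mp /=.
  by rewrite [X in measurable X](_ : _ = setT)//; apply/seteqP; split.
rewrite [X in measurable X](_ : _ =
  [set w | p s w] `&` [set w | all (p^~ w) L]).
  apply: measurableI; first by apply: mp; rewrite inE eqxx.
  by apply: IH => i iL; apply: mp; rewrite inE iL orbT.
by apply/seteqP; split=> w /= => [/andP[]|[-> ->]].
Qed.

Lemma measurable_head_bits (p : seq bool -> conf -> bool) (L : seq (seq bool))
    (s0 s1 : seq bool) : (forall s, measurable [set w | p s w]) ->
  measurable [set w | head s0 [seq s <- L | p s w] = s1].
Proof.
move=> mp; elim: L => [|s L IH] /=.
  case: (eqVneq s0 s1) => h; first rewrite h.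
    by rewrite [X in measurable X](_ : _ = setT)//; apply/seteqP; split.
  rewrite [X in measurable X](_ : _ = set0)//; apply/seteqP; split=> // w /=.
  exact/eqP.
have -> : [set w | head s0 (if p s w then s :: [seq s <- L | p s w]
    else [seq s <- L | p s w]) = s1] =
  ([set w | p s w] `&` [set _ | s = s1]) `|`
  (~` [set w | p s w] `&` [set w | head s0 [seq s <- L | p s w] = s1]).
  apply/seteqP; split=> w /=.
    by case: (p s w) => /= h; [left|right; split].
  by case: (p s w) => -[] [].
apply: measurableU; apply: measurableI => //; last exact: measurableC.
case: (eqVneq s s1) => h.
  by rewrite [X in measurable X](_ : _ = setT)//; apply/seteqP; split.
rewrite [X in measurable X](_ : _ = set0)//; apply/seteqP; split=> // w /=.
exact/eqP.
Qed.

Lemma measurable_weight_lt x k s (t : R) : (x, k) \in Xi ->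
  measurable [set w : conf | weight x k s w < t].
Proof.
move=> xk; rewrite -[X in measurable X]setTI.
rewrite [X in _ `&` X](_ : _ = weight x k s @^-1` [set` `]-oo, t[]); last first.
  by apply/seteqP; split=> w /=; rewrite in_itv.
exact: measurable_weight.
Qed.

Lemma measurable_weight_le x k s (t : R) : (x, k) \in Xi ->
  measurable [set w : conf | weight x k s w <= t].
Proof.
move=> xk; rewrite -[X in measurable X]setTI.
rewrite [X in _ `&` X](_ : _ = weight x k s @^-1` [set` `]-oo, t]]); last first.
  by apply/seteqP; split=> w /=; rewrite in_itv.
exact: measurable_weight.
Qed.

Lemma measurable_stuck r N y k (t : R) : (y, k) \in Xi ->
  measurable (stuck r N y k t).
Proof.
move=> yk; apply: measurable_all_bits => s _; case: (toward r y s) => /=.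
  exact: measurable_weight_lt.
by rewrite [X in measurable X](_ : _ = setT)//; apply/seteqP; split.
Qed.

Lemma endpoint_place r y k s :
  endpoint y (map (eqb r) s) = (place r y k (endpoint 0 s, 0%N)).1.
Proof.
have cE : count (preim (eqb r) id) s = if r then count id s else (size s - count id s)%N.
  rewrite -(count_predC id s); case: r; last rewrite addKn.
    by apply: eq_count => -[].
  by apply: eq_count => -[].
rewrite !endpointE count_map size_map cE /place/=.
by have := count_size id s; case: r {cE}; lia.
Qed.

Lemma toward_place r y s : toward r y (map (eqb r) s) = toward true 0 s.
Proof.
rewrite /toward (endpoint_place r y 0) /place /=.
by case: r; apply/idP/idP; lia.
Qed.

Lemma stuck_place r N y k (t : R) (w : conf) :
  stuck r N y k t w <-> stuck true N 0 0 t (relabel (place_edge r y k) w).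
Proof.
have rK : involutive (map (eqb r)).
  by move=> s; rewrite -map_comp map_id_in// => -[] _; case: (r).
have WE s : weight 0 0 s (relabel (place_edge r y k) w) =
    weight y k (map (eqb r) s) w.
  rewrite (weight_place r y k 0 0 s w) /place /= addn0.
  by case: (r); rewrite ?addr0 ?subr0.
split=> /stuckP h; apply/stuckP => s sN sr.
  by rewrite WE; apply: h; rewrite ?size_map// toward_place.
rewrite -[s]rK -WE; apply: h; first by rewrite size_map.
by rewrite -(toward_place r y) rK.
Qed.

Lemma depends_stuck r N y k (t : R) : (y, k) \in Xi ->
  depends_on [set` box y N k N] (stuck r N y k t).
Proof.
move=> yk w w' ww; rewrite /stuck /=; congr is_true.
apply: eq_in_all => s; rewrite mem_bitseqs => /eqP sN.
by rewrite (@depends_weight _ y k s yk w w')// sN.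
Qed.

Lemma place_edge_E r y k : (y, k) \in Xi -> forall e, E e ->
  E (place_edge r y k e).
Proof.
move=> + [[x1 k1] [x2 k2]].
rewrite /E /is_edge /Xi /in_mem /place_edge /place /=.
by case: r => yk /and3P[/= ? ? ?]; apply/and3P; split; lia.
Qed.

Lemma prob_stuck r N y k (t : R) : (y, k) \in Xi ->
  Q (stuck r N y k t) = Q (stuck true N 0 0 t).
Proof.
move=> yk; have m0 : measurable (stuck true N 0 0 t) by exact: measurable_stuck.
have m1 := measurable_stuck r N t yk.
have E0 w : (\1_(stuck true N 0 0 t) (relabel (place_edge r y k) w) : R) =
    \1_(stuck r N y k t) w.
  rewrite !indicE; congr (nat_of_bool _)%:R.
  apply/idP/idP; rewrite !inE => h; first exact: (stuck_place r N y k t w).2.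
  exact: (stuck_place r N y k t w).1.
rewrite -!integral1E//; under eq_integral do rewrite -E0.
apply: (integral_relabel (f := fun w => (\1_(stuck true N 0 0 t) w)%:E) resampleQ
  (s := place_edge r y k) (l := box 0 N 0 N)).
- exact: place_edge_inj.
- exact: box_E.
- by move=> e /box_E; exact: place_edge_E.
- exact: nnmeas_indic.
- rewrite (_ : _ \o _ = fun w => (\1_(stuck r N y k t) w)%:E).
    exact: nnmeas_indic.
  by apply/funext => w /=; rewrite E0.
- move=> w w' ww; rewrite !indicE; congr (nat_of_bool _)%:R%:E.
  exact: (congr1 asbool (depends_stuck true t (isT : ((0 : int), 0%N) \in Xi) ww)).
Qed.

Definition below n (T : R) : set conf :=
  [set w | forall s, size s = n -> weight 0 0 s w <= T].

Lemma measurable_below n T : measurable (below n T).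
Proof.
rewrite (_ : below n T = [set w | all (fun s => weight 0 0 s w <= T) (bitseqs n)]).
  by apply: measurable_all_bits => s _; exact: measurable_weight_le.
apply/seteqP; split=> w /= h.
  by apply/allP => s; rewrite mem_bitseqs => /eqP; exact: h.
by move=> s sn; apply: (allP h); rewrite mem_bitseqs sn.
Qed.

(** The two events [stuck] are decreasing and equally likely, and together they force all paths
    below [t], so the square of their probability is at most [eta ^+ 4]. The power 4 allows two
    square roots: one here, one in [layer_bound]. *)
Lemma prob_stuck_le r N y k (t eta : R) : (y, k) \in Xi -> 0 <= eta ->
  (Q (below N t) <= (eta ^+ 4)%:E)%E ->
  (Q (stuck r N y k t) <= (eta ^+ 2)%:E)%E.
Proof.
move=> yk eta0 Qt.
have o0 : ((0 : int), 0%N) \in Xi by [].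
have ms b : measurable (stuck b N 0 0 t) by exact: measurable_stuck.
pose f b := fun w : conf => (\1_(stuck b N 0 0 t) w)%:E : \bar R.
have df b : decreasing_le1 (f b).
  split; first exact: nnmeas_indic.
    by move=> w; rewrite /f lee_fin indicE lern1 leq_b1.
  move=> w w' ww; rewrite /f lee_fin !indicE ler_nat.
  case: (boolP (w' \in _)) => // /set_mem /stuckP h; rewrite mem_set//.
  apply/stuckP => s sN st; apply: le_lt_trans (h s sN st).
  by rewrite !weightE; apply: ler_sum => e _; exact: ww.
have lf b : depends_on [set` box 0 N 0 N] (f b).
  move=> w w' ww; rewrite /f !indicE; congr (nat_of_bool _)%:R%:E.
  exact: (congr1 asbool (depends_stuck b t o0 ww)).
have := harris resampleQ (@box_E _ _ _ _) (df true) (df false) (lf true) (lf false).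
rewrite /f integral1E// integral1E//.
rewrite (prob_stuck false N t o0) -(prob_stuck r N t yk) => hq.
have : (Q (stuck r N y k t) * Q (stuck r N y k t) <= (eta ^+ 4)%:E)%E.
  apply: le_trans Qt; apply: (le_trans hq).
  apply: (@le_trans _ _ (Q (stuck true N 0 0 t `&` stuck false N 0 0 t))).
    rewrite -integral1E; last exact: measurableI.
    by apply: le_of_eq; apply: eq_integral => w _; rewrite -EFinM indicI.
  apply: le_measure; rewrite ?inE; [exact: measurableI|exact: measurable_below|].
  move=> w /= [/stuckP h1 /stuckP h2] s sN; apply: ltW.
  by case/orP: (le_total (0 : int) (endpoint 0 s)) => [/(h1 s sN)|/(h2 s sN)].
have Qfin : Q (stuck r N y k t) \is a fin_num.
  by apply: fin_num_measure; exact: measurable_stuck.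
rewrite -(fineK Qfin) -EFinM !lee_fin.
have : (0 <= fine (Q (stuck r N y k t)))%R by rewrite fine_ge0.
set q := fine _ => q0 qq; rewrite -(ler_pXn2r (ltn0Sn 1)) ?nnegrE ?sqr_ge0//.
by rewrite -exprM expr2.
Qed.

End environment.

(** * Walks confined to strips *)

Section strips.
Context {R : realType}.
Local Notation conf := (@config R (vertex * vertex)%type E).
Local Notation gam := (@std_normal R).
Context (Q : probability conf R).
Hypothesis resampleQ : forall e (f : conf -> \bar R), E e -> nnmeas f ->
  (\int[Q]_x f x = \int[Q]_x resample gam e f x)%E.
Context (N : nat) (t lam : R).
Implicit Types (x y c : int) (k n J : nat) (b r : bool) (s : seq bool).

(** The default is the straight path: it respects the direction [r], and being deterministic it has
    explicit exponential moments. *)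
Definition layer_path r y k (w : conf) : seq bool :=
  head (nseq N r) [seq s <- bitseqs N | toward r y s && (t <= weight y k s w)].

Lemma toward_nseq r y : toward r y (nseq N r).
Proof.
rewrite /toward endpointE count_nseq size_nseq.
by case: r => /=; rewrite ?mul1n ?mul0n; lia.
Qed.

Lemma layer_pathP r y k w :
  [/\ size (layer_path r y k w) = N, toward r y (layer_path r y k w) &
   (~ stuck r N y k t w -> t <= weight y k (layer_path r y k w) w) /\
   (stuck r N y k t w -> layer_path r y k w = nseq N r)].
Proof.
rewrite /layer_path; set L := [seq _ <- _ | _].
have LP s : s \in L -> [/\ size s = N, toward r y s & t <= weight y k s w].
  by rewrite mem_filter mem_bitseqs => /andP[/andP[? ?] /eqP].
case LE: L => [|s L'] /=.
  split; [by rewrite size_nseq|exact: toward_nseq|split=> // /stuckP H].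
  exfalso; apply: H => s sN st; rewrite ltNge; apply/negP => ts.
  have : s \in L by rewrite mem_filter st ts mem_bitseqs sN eqxx.
  by rewrite LE.
have [sN st ts] : [/\ size s = N, toward r y s & t <= weight y k s w].
  by apply: LP; rewrite LE inE eqxx.
split=> //; split=> // /stuckP /(_ s sN st).
by rewrite ltNge ts.
Qed.

Lemma measurable_layer_path r y k s : (y, k) \in Xi ->
  measurable [set w | layer_path r y k w = s].
Proof.
move=> yk; apply: measurable_head_bits => s'.
case: (toward r y s') => /=; last first.
  by rewrite [X in measurable X](_ : _ = set0)//; apply/seteqP; split.
rewrite [X in measurable X](_ : _ = ~` [set w | weight y k s' w < t]).
  by apply: measurableC; exact: measurable_weight_lt.
by apply/seteqP; split=> w /=; rewrite leNgt => /negP.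
Qed.

Lemma depends_layer_path r y k : (y, k) \in Xi ->
  depends_on [set` box y N k N] (layer_path r y k).
Proof.
move=> yk w w' ww; rewrite /layer_path; congr head.
apply: eq_in_filter => s; rewrite mem_bitseqs => /eqP sN.
by rewrite (@depends_weight _ y k s yk w w')// sN.
Qed.

Lemma nnmeas_sum (I : eqType) (L : seq I) (f : I -> conf -> \bar R) :
  (forall i, i \in L -> nnmeas (f i)) -> nnmeas (fun w => \sum_(i <- L) f i w)%E.
Proof.
move=> nf; split=> [|w]; last first.
  by rewrite big_seq; apply: sume_ge0 => i iL; case: (nf i iL).
elim: L nf => [|i L IH] nf.
  by apply: (eq_measurable_fun (fun _ : conf => 0%E : \bar R)) => // w _;
    rewrite big_nil.
apply: (eq_measurable_fun (fun w => f i w + \sum_(j <- L) f j w)%E) => [w _|].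
  by rewrite big_cons.
apply: emeasurable_funD.
  by case: (nf i (mem_head _ _)).
by apply: IH => j jL; apply: nf; rewrite inE jL orbT.
Qed.

Lemma integral_sum_seq (I : eqType) (L : seq I) (f : I -> conf -> \bar R) :
  (forall i, i \in L -> nnmeas (f i)) ->
  (\int[Q]_w (\sum_(i <- L) f i w) = \sum_(i <- L) \int[Q]_w f i w)%E.
Proof.
elim: L => [|i L IH] nf.
  by rewrite big_nil; under eq_integral do rewrite big_nil; rewrite integral0.
under eq_integral do rewrite big_cons.
have nL j : j \in L -> nnmeas (f j) by move=> jL; apply: nf; rewrite inE jL orbT.
have [mi i0] := nf i (mem_head _ _); have [mL L0] := nnmeas_sum nL.
by rewrite ge0_integralD// IH// big_cons.
Qed.

Lemma nnmeas_prod (L : nat) (f : nat -> conf -> \bar R) :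
  (forall i, nnmeas (f i)) -> nnmeas (fun w => \prod_(i < L) f i w)%E.
Proof.
move=> nf; elim: L => [|L IH].
  split=> [|w]; last by rewrite big_ord0.
  by apply: (eq_measurable_fun (fun _ : conf => 1%E : \bar R)) => // w _;
    rewrite big_ord0.
rewrite (_ : (fun w => _) = (fun w => \prod_(i < L) f i w) \* f L)%E.
  exact: nnmeasM.
by apply/funext => w; rewrite big_ord_recr.
Qed.

(** Splitting according to the value [s] of the layer path makes the start of the next layer
    deterministic, so that independence can be applied to fixed sets of edges. *)
Definition layer_term r y k s (w : conf) : \bar R :=
  (\1_[set w | layer_path r y k w = s] w * expR (- lam * weight y k s w))%:E.

Lemma nnmeas_expR_weight a y k s : (y, k) \in Xi ->
  nnmeas (fun w : conf => (expR (a * weight y k s w))%:E).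
Proof.
move=> yk; apply: nnmeas_EFin => [|w]; last exact: expR_ge0.
apply: measurableT_comp => //; apply: measurable_funM => //.
exact: measurable_weight.
Qed.

Lemma nnmeas_layer_term r y k s : (y, k) \in Xi -> nnmeas (layer_term r y k s).
Proof.
move=> yk; rewrite (_ : layer_term _ _ _ _ =
  (fun w => (\1_[set w | layer_path r y k w = s] w)%:E) \*
  (fun w : conf => (expR (- lam * weight y k s w))%:E))%E.
  apply: nnmeasM; last exact: nnmeas_expR_weight.
  by apply: nnmeas_indic; exact: measurable_layer_path.
by apply/funext => w; rewrite /layer_term EFinM.
Qed.

Lemma depends_layer_term r y k s : (y, k) \in Xi -> size s = N ->
  depends_on [set` box y N k N] (layer_term r y k s).
Proof.
move=> yk sN w w' ww; rewrite /layer_term !indicE; congr (_%:R * expR (_ * _))%:E.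
  congr nat_of_bool; apply: (congr1 asbool) => /=.
  by rewrite (depends_layer_path r yk ww).
by apply: depends_weight => //; rewrite sN.
Qed.

Lemma sum_layer_term r y k (F : seq bool -> \bar R) w :
  (\sum_(s <- bitseqs N) (layer_term r y k s w * F s) =
   (expR (- lam * weight y k (layer_path r y k w) w))%:E *
     F (layer_path r y k w))%E.
Proof.
have [sN _ _] := layer_pathP r y k w.
rewrite (bigD1_seq (layer_path r y k w)) ?uniq_bitseqs//=; last first.
  by rewrite mem_bitseqs sN.
rewrite big1 ?adde0 => [|s sp].
  by rewrite /layer_term indicE mem_set// mul1r.
rewrite /layer_term indicE memNset ?mul0r ?mul0e//= => ps.
by rewrite ps eqxx in sp.
Qed.

Context (eta : R).
Hypotheses (lam0 : 0 <= lam) (eta0 : 0 < eta).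
Hypothesis stuckQ : forall r y k, (y, k) \in Xi ->
  (Q (stuck r N y k t) <= (eta ^+ 2)%:E)%E.

(** The first term comes from layers that are not stuck. On a stuck layer
    [v <= eta / 2 * v ^+ 2 + eta^-1 / 2], where [v ^+ 2] has mean [expR (2 * lam ^+ 2 * N%:R)] along
    the straight path and being stuck has probability at most [eta ^+ 2]. *)
Definition layer_rate : R :=
  expR (- lam * t) + eta / 2 * (expR (2 * lam ^+ 2 * N%:R) + 1).

Lemma layer_rate_ge0 : 0 <= layer_rate.
Proof.
by rewrite /layer_rate addr_ge0 ?expR_ge0// mulr_ge0 ?divr_ge0// ?(ltW eta0)//.
Qed.

Lemma layer_bound r y k : (y, k) \in Xi ->
  (\int[Q]_w (expR (- lam * weight y k (layer_path r y k w) w))%:E <=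
   layer_rate%:E)%E.
Proof.
move=> yk; have [ng0 np0] := (nnmeas_expR_weight (- (2 * lam)) (nseq N r) yk,
  nnmeas_indic (measurable_stuck r N t yk)).
set f := fun w : conf => _; set g0 := (fun w : conf => _) in ng0.
set p0 := (fun w : conf => _) in np0.
have nf : nnmeas f.
  rewrite (_ : f = fun w => \sum_(s <- bitseqs N) layer_term r y k s w)%E.
    by apply: nnmeas_sum => s _; exact: nnmeas_layer_term.
  apply/funext => w; have := sum_layer_term r y k (fun=> 1%E) w.
  by rewrite /f mule1 => <-; apply: eq_bigr => s _; rewrite mule1.
have [mf f0] := nf; have [mg0 g00] := ng0; have [mp0 p00] := np0.
have e2 : 0 <= eta / 2 by rewrite divr_ge0// ltW.
have ie : 0 <= eta^-1 / 2 by rewrite divr_ge0// invr_ge0 ltW.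
pose h w := ((expR (- lam * t))%:E +
  ((eta / 2)%:E * g0 w + (eta^-1 / 2)%:E * p0 w))%E.
have mg1 : measurable_fun setT (fun w : conf => (eta / 2)%:E * g0 w)%E.
  exact: emeasurable_funM.
have mp1 : measurable_fun setT (fun w : conf => (eta^-1 / 2)%:E * p0 w)%E.
  exact: emeasurable_funM.
have g10 (w : conf) : (0 <= (eta / 2)%:E * g0 w)%E by rewrite mule_ge0.
have p10 (w : conf) : (0 <= (eta^-1 / 2)%:E * p0 w)%E by rewrite mule_ge0.
apply: (@le_trans _ _ (\int[Q]_w h w)%E).
  apply: ge0_le_integral => //.
    by apply: emeasurable_funD => //; exact: emeasurable_funD.
  move=> w _; rewrite /f /h /g0 /p0 -!EFinM -!EFinD lee_fin.
  have [_ _ [h1 h2]] := layer_pathP r y k w.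
  case: (pselect (stuck r N y k t w)) => sw.
    rewrite indicE mem_set// h2// mulr1.
    set S := weight _ _ _ _.
    have -> : - (2 * lam) * S = - lam * S + - lam * S by ring.
    rewrite expRD; set v := expR (- lam * S).
    apply: (@le_trans _ _ (eta / 2 * (v * v) + eta^-1 / 2)); last first.
      by rewrite lerDr expR_ge0.
    have ei : eta * eta^-1 = 1 by rewrite divff// gt_eqF.
    (* Young's inequality, in place of Cauchy-Schwarz, separates [v] from the indicator of the stuck
       event. *)
    have : 0 <= eta^-1 * (eta * v - 1) ^+ 2.
      by rewrite mulr_ge0 ?sqr_ge0// invr_ge0 ltW.
    have -> : eta^-1 * (eta * v - 1) ^+ 2 =
      (eta * eta^-1) * (eta * (v * v)) - 2 * (eta * eta^-1) * v + eta^-1 by ring.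
    by rewrite ei; lra.
  rewrite indicE memNset// mulr0 addr0.
  apply: (@le_trans _ _ (expR (- lam * t))).
    by rewrite ler_expR ler_wnM2l ?oppr_le0//; exact: h1.
  by rewrite lerDl mulr_ge0// expR_ge0.
rewrite ge0_integralD//; last first.
- exact: emeasurable_funD.
- by move=> w _; rewrite adde_ge0.
rewrite integral_cst//= ge0_integralD// ge0_integralZl_EFin//.
rewrite ge0_integralZl_EFin// integral_expR_weight// integral1E; last first.
  exact: measurable_stuck.
have -> : Q setT = 1%E by exact: probability_setT.
rewrite mule1 size_nseq /layer_rate mulrDr mulr1 !EFinD leeD2l// leeD//.
  by rewrite -EFinM lee_fin sqrrN exprMn; apply: le_of_eq; congr (_ * expR _); field.
apply: (@le_trans _ _ ((eta^-1 / 2)%:E * (eta ^+ 2)%:E)%E).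
  by rewrite lee_pmul2l//; [exact: stuckQ|rewrite lte_fin divr_gt0// invr_gt0].
by rewrite -EFinM lee_fin expr2 mulrAC !mulrA mulVf ?gt_eqF// mul1r.
Qed.

(** Each layer heads for the axis [c] and overshoots it by at most [N]. Layers started within [N] of
    the axis thus end within [N] of it, and the walk looks only at edges within [2 * N]. *)
Fixpoint walk J c y k (w : conf) : seq bool :=
  if J is J'.+1 then
    let s := layer_path (y <= c) y k w in
    s ++ walk J' c (endpoint y s) (k + N) w
  else [::].

Lemma size_walk J c y k w : size (walk J c y k w) = (J * N)%N.
Proof.
elim: J y k => //= J IH y k; rewrite size_cat IH mulSn.
by have [-> _ _] := layer_pathP (y <= c) y k w.
Qed.

Definition walk_exp J c y k (w : conf) : \bar R :=
  (expR (- lam * weight y k (walk J c y k w) w))%:E.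

Lemma walk_expS J c y k w : walk_exp J.+1 c y k w =
  (\sum_(s <- bitseqs N) (layer_term (y <= c)%R y k s w *
     walk_exp J c (endpoint y s) (k + N) w))%E.
Proof.
rewrite (sum_layer_term _ _ _ (fun s => walk_exp J c (endpoint y s) (k + N) w)).
rewrite /walk_exp /= weight_cat mulrDr expRD EFinM.
by have [-> _ _] := layer_pathP (y <= c) y k w.
Qed.

Lemma Xi_layer y k s : (y, k) \in Xi -> s \in bitseqs N ->
  (endpoint y s, (k + N)%N) \in Xi.
Proof. by move=> yk; rewrite mem_bitseqs => /eqP <-; exact: Xi_endpoint. Qed.

Lemma nnmeas_walk_exp J c y k : (y, k) \in Xi -> nnmeas (walk_exp J c y k).
Proof.
elim: J y k => [|J IH] y k yk; first exact: nnmeas_expR_weight.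
rewrite (_ : walk_exp _ _ _ _ = fun w => \sum_(s <- bitseqs N)
  (layer_term (y <= c)%R y k s w * walk_exp J c (endpoint y s) (k + N) w))%E;
  last by apply/funext => w; rewrite walk_expS.
apply: nnmeas_sum => s sb; apply: nnmeasM; first exact: nnmeas_layer_term.
by apply: IH; exact: Xi_layer.
Qed.

Lemma depends_walk_level J c y k : (y, k) \in Xi ->
  depends_on [set e : vertex * vertex | (k <= e.1.2)%N] (walk_exp J c y k).
Proof.
elim: J y k => [|J IH] y k yk w w' ww //.
rewrite !walk_expS; apply: eq_big_seq => s sb; congr (_ * _)%E.
  apply: depends_layer_term => //.
    by move: sb; rewrite mem_bitseqs => /eqP.
  move=> e /= eb; apply: ww => /=; have [z [j [b ejb]]] := box_edge eb.
  by move: eb; rewrite ejb mem_box /= => /and3P[_ /andP[]].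
apply: IH; first exact: Xi_layer.
by move=> e /= ke; apply: ww; rewrite /= (leq_trans _ ke)// leq_addr.
Qed.

(** For each value of the first layer path, the rest of the walk uses only levels from [k + N] on,
    hence is independent of it; its bound is uniform in the starting point. *)
Lemma integral_walk_exp J c y k : (y, k) \in Xi ->
  (\int[Q]_w walk_exp J c y k w <= (layer_rate ^+ J)%:E)%E.
Proof.
elim: J y k => [|J IH] y k yk.
  rewrite expr0 /walk_exp /=; under eq_integral do rewrite mulr0 expR0.
  by rewrite integral_cst// mul1e; apply: le_of_eq; exact: probability_setT.
under eq_integral do rewrite walk_expS.
have nT s := nnmeas_layer_term (y <= c) s yk.
rewrite integral_sum_seq => [|s sb]; last first.
  by apply: nnmeasM => //; apply: nnmeas_walk_exp; exact: Xi_layer.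
rewrite big_seq.
apply: (@le_trans _ _ (\sum_(s <- bitseqs N | s \in bitseqs N)
    (\int[Q]_w layer_term (y <= c)%R y k s w) * (layer_rate ^+ J)%:E)%E).
  apply: lee_sum => s sb; have xs := Xi_layer yk sb.
  rewrite (integral_indep resampleQ (l := box y N k N)
    (S := [set e : vertex * vertex | (k + N <= e.1.2)%N])) //; last first.
  - move=> e eb /= ke; have [z [j [b ejb]]] := box_edge eb.
    move: ke eb; rewrite ejb mem_box /= => ke /and3P[_ /andP[_]].
    by rewrite ltnNge ke.
  - exact: depends_walk_level.
  - by apply: depends_layer_term => //; move: sb; rewrite mem_bitseqs => /eqP.
  - exact: nnmeas_walk_exp.
  - exact: box_E.
  apply: lee_wpmul2l; last exact: IH.
  by apply: integral_ge0 => w _; case: (nT s).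
rewrite -ge0_sume_distrl; last first.
  by move=> s _; apply: integral_ge0 => w _; case: (nT s).
rewrite -big_seq -integral_sum_seq//.
rewrite exprS EFinM; apply: lee_wpmul2r.
  by rewrite lee_fin exprn_ge0// layer_rate_ge0.
apply: le_trans (layer_bound (y <= c) yk); apply: le_of_eq; apply: eq_integral => w _.
have := sum_layer_term (y <= c) y k (fun=> 1%E) w.
by rewrite mule1 => <-; apply: eq_bigr => s _; rewrite mule1.
Qed.

Lemma depends_walk J c y k : (y, k) \in Xi -> `|y - c| <= N%:Z ->
  depends_on [set` box c (2 * N) k (J * N)] (walk_exp J c y k).
Proof.
elim: J y k => [|J IH] y k yk yc w w' ww //.
rewrite !walk_expS; apply: eq_big_seq => s sb.
have sN : size s = N by move: sb; rewrite mem_bitseqs => /eqP.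
(* A path in the wrong direction is never selected, so its term vanishes and its endpoint need not
   lie in the strip. *)
have [st|st] := boolP (toward (y <= c) y s); last first.
  have T0 v : layer_term (y <= c) y k s v = 0%E.
    rewrite /layer_term indicE memNset ?mul0r//= => lp.
    by have [_] := layer_pathP (y <= c) y k v; rewrite lp (negbTE st).
  by rewrite !T0 !mul0e.
congr (_ * _)%E.
  apply: depends_layer_term => // e /= eb; apply: ww.
  by apply: box_subset eb; rewrite ?mulSn; lia.
apply: IH; first exact: Xi_layer.
  have := endpoint_bound y s; move: st; rewrite /toward sN.
  by case: ifP => yc'; lia.
by move=> e /= eb; apply: ww; apply: box_subset eb; rewrite ?mulSn; lia.
Qed.

(** Each walk reads edges within [2 * N] of its axis; axes more than [4 * N] apart make these sets
    disjoint. *)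
Lemma integral_strips J k M (c : nat -> int) :
  (forall i, (c i, k) \in Xi) ->
  (forall i j, (i < j < M)%N -> (4 * N)%:Z < c j - c i) ->
  (\int[Q]_w (\prod_(i < M) walk_exp J (c i) (c i) k w) <=
   (layer_rate ^+ (J * M))%:E)%E.
Proof.
move=> cX cS; have cM i := nnmeas_walk_exp J (c i) (cX i).
have nP L : nnmeas (fun w => \prod_(i < L) walk_exp J (c i) (c i) k w)%E.
  exact: (@nnmeas_prod L (fun i => walk_exp J (c i) (c i) k)).
elim: M cS => [|M IH] cS.
  rewrite muln0 expr0; under eq_integral do rewrite big_ord0.
  by rewrite integral_cst// mul1e; apply: le_of_eq; exact: probability_setT.
have {}IH : (\int[Q]_w (\prod_(i < M) walk_exp J (c i) (c i) k w) <=
    (layer_rate ^+ (J * M))%:E)%E.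
  by apply: IH => i j /andP[ij jM]; apply: cS; rewrite ij ltnS ltnW.
under eq_integral do rewrite big_ord_recr /= muleC.
rewrite (integral_indep resampleQ (l := box (c M) (2 * N) k (J * N))
  (S := [set e | exists2 i, (i < M)%N & e \in box (c i) (2 * N) k (J * N)]))//.
- rewrite mulnS exprD EFinM; apply: lee_pmul => //.
  + by apply: integral_ge0 => w _; case: (cM M).
  + by apply: integral_ge0 => w _; case: (nP M).
  + exact: integral_walk_exp.
- exact: box_E.
- exact: nP.
- by apply: depends_walk => //; rewrite subrr.
- move=> w w' ww; apply: eq_bigr => i _; apply: depends_walk => //.
    by rewrite subrr.
  by move=> e /= eb; apply: ww; exists i.
move=> e eb [i iM ei]; have [z [j [b ejb]]] := box_edge eb.
have := cS i M; rewrite iM ltnSn => /(_ isT); move: eb ei.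
rewrite ejb !mem_box => /and3P[+ _ _] /and3P[+ _ _].
by lia.
Qed.

End strips.

(** * Rays and the upper bound *)

Section rays.
Implicit Types (i k K M : nat).

(* The ray of slope [i / M]: after [k] steps it has made [k * i %/ M] steps to
   the right. *)
Definition ray M i K : seq bool :=
  [seq (k * i %/ M < k.+1 * i %/ M)%N | k <- iota 0 K].

Definition ray_at M i k : int := (2 * (k * i %/ M))%N%:Z - k%:Z.

Lemma ray_step M i k : (i <= M)%N ->
  step (ray_at M i k) (k * i %/ M < k.+1 * i %/ M)%N = ray_at M i k.+1.
Proof.
case: M => [|M] iM.
  by move: iM; rewrite leqn0 => /eqP ->; rewrite /ray_at /step !divn0 /=; lia.
have h1 : (k * i %/ M.+1 <= k.+1 * i %/ M.+1)%N.
  by apply: leq_div2r; rewrite leq_mul2r leqnSn orbT.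
have h2 : (k.+1 * i %/ M.+1 <= (k * i %/ M.+1).+1)%N.
  have -> : ((k * i %/ M.+1).+1 = (k * i + M.+1) %/ M.+1)%N.
    by rewrite divnDr ?dvdnn// divnn addn1.
  by apply: leq_div2r; rewrite mulSn addnC leq_add2l.
by rewrite /ray_at /step; case: ifP => h; lia.
Qed.

Lemma path_edges_rayP M i k K e : (i <= M)%N ->
  e \in path_edges (ray_at M i k) k
    [seq (j * i %/ M < j.+1 * i %/ M)%N | j <- iota k K] ->
  e.1 = (ray_at M i e.1.2, e.1.2) /\ (k <= e.1.2 < k + K)%N.
Proof.
move=> iM; elim: K k => //= K IH k; rewrite inE => /orP[/eqP -> /=|].
  by split=> //; lia.
by rewrite ray_step// => /IH[-> /= ?]; split=> //; lia.
Qed.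

Lemma endpoint_ray M i k K : (i <= M)%N ->
  endpoint (ray_at M i k) [seq (j * i %/ M < j.+1 * i %/ M)%N | j <- iota k K] =
  ray_at M i (k + K).
Proof.
move=> iM; elim: K k => [|K IH] k /=; first by rewrite addn0.
by rewrite ray_step// IH addSnnS.
Qed.

Lemma ray_at0 M i : ray_at M i 0 = 0.
Proof. by rewrite /ray_at mul0n div0n. Qed.

Lemma endpoint_ray0 M i K : (i <= M)%N -> endpoint 0 (ray M i K) = ray_at M i K.
Proof. by move=> iM; have := endpoint_ray 0 K iM; rewrite ray_at0 add0n. Qed.

Lemma size_ray M i K : size (ray M i K) = K.
Proof. by rewrite size_map size_iota. Qed.

Definition fan M K : seq (vertex * vertex) :=
  flatten [seq path_edges 0 0 (ray M i K) | i <- iota 0 M].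

(* At level [k] at most [M / k + 1] of the rays go through a given vertex. *)
Definition crowd M k : nat := if k is 0 then M else (M %/ k).+1.

Lemma count_same_ray M k u :
  (count (fun i => k * i %/ M == u) (iota 0 M) <= crowd M k)%N.
Proof.
case: k => [|k]; first by rewrite (leq_trans (count_size _ _))// size_iota.
have [->//|M0] := posnP M.
(* [a] is the ceiling of [u M / (k + 1)], the least possible index; the admissible indices lie among
   the [M %/ k.+1 + 1] consecutive integers starting there. *)
rewrite -size_filter /=; pose a := ((u * M + k) %/ k.+1)%N.
rewrite -(size_iota a (M %/ k.+1).+1); apply: uniq_leq_size.
  by rewrite filter_uniq// iota_uniq.
move=> i; rewrite mem_filter !mem_iota => /andP[/eqP iu _].
have h1 : (u * M <= k.+1 * i)%N by rewrite -iu leq_divM.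
have h2 : (k.+1 * i < u * M + M)%N.
  by rewrite -iu addnC -mulSn; exact: ltn_ceil.
have h3 : (u * M + k < (a.+1) * k.+1)%N by exact: ltn_ceil.
have h4 : (a * k.+1 <= u * M + k)%N by exact: leq_divM.
have ai : (a <= i)%N.
  by rewrite /a -ltnS ltn_divLR//; lia.
rewrite ai /= addnS ltnS -leq_subLR leq_divRL//.
by rewrite mulnBl; lia.
Qed.

Lemma count_fan M K i e : (i < M)%N -> e \in path_edges 0 0 (ray M i K) ->
  (count_mem e (fan M K) <= crowd M e.1.2)%N.
Proof.
move=> iM ei; have eiE := (path_edges_rayP (ltnW iM)).
rewrite /fan count_flatten -map_comp.
apply: leq_trans (count_same_ray M e.1.2 (e.1.2 * i %/ M)%N).
rewrite -sum1_count [leqRHS]big_mkcond /= sumnE big_map.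
rewrite big_seq [leqRHS]big_seq; apply: leq_sum => j; rewrite mem_iota => /= jM.
rewrite count_uniq_mem ?path_edges_uniq//.
case: (boolP (e \in _)) => // ej.
have := ei; rewrite -(ray_at0 M i) => /eiE[e1 _].
have := ej; rewrite -(ray_at0 M j) => /(path_edges_rayP (ltnW jM))[e2 _].
move: e1; rewrite e2 /ray_at => -[e12].
by rewrite (_ : (_ == _) = true)//; apply/eqP; lia.
Qed.

Lemma sum_path_edges_level x k s (F : nat -> nat) :
  (\sum_(e <- path_edges x k s) F e.1.2 = \sum_(j <- iota k (size s)) F j)%N.
Proof.
by elim: s x k => [|b s IH] x k /=; rewrite ?big_nil// !big_cons IH.
Qed.

(** By [integral_expR_multisum] the left side is the variance of the total weight of the [M] rays.
    When [K] is of order [M], the right side is of order [M^2 log M]. *)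
Lemma sum_count_fan M K :
  (\sum_(e <- fan M K) count_mem e (fan M K) <=
   M * \sum_(k < K) crowd M k)%N.
Proof.
rewrite [leqLHS]big_flatten big_map.
apply: (@leq_trans (\sum_(i <- iota 0 M) \sum_(k < K) crowd M k)%N).
  rewrite big_seq [leqRHS]big_seq; apply: leq_sum => i; rewrite mem_iota add0n => /= iM.
  rewrite -(big_mkord xpredT) /index_iota subn0.
  have -> : (\sum_(k <- iota 0 K) crowd M k =
      \sum_(e <- path_edges 0 0 (ray M i K)) crowd M e.1.2)%N.
    by rewrite sum_path_edges_level size_ray.
  rewrite big_seq [leqRHS]big_seq.
  by apply: leq_sum => e ei; exact: count_fan iM ei.
by rewrite big_const_seq count_predT size_iota iter_addn_0 mulnC.
Qed.

Lemma fan_E M K : {in fan M K, forall e, E e}.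
Proof.
move=> e /flatten_mapP[i _]; apply: path_edges_E; by [].
Qed.

End rays.

(** * Exponential Chebyshev bound for rays followed by strips *)

Section upper_bound.
Context {R : realType}.
Local Notation conf := (@config R (vertex * vertex)%type E).
Local Notation gam := (@std_normal R).
Context (Q : probability conf R).
Hypothesis resampleQ : forall e (f : conf -> \bar R), E e -> nnmeas f ->
  (\int[Q]_x f x = \int[Q]_x resample gam e f x)%E.
Context (N : nat) (t lam eta : R).
Hypotheses (lam0 : 0 <= lam) (eta0 : 0 < eta) (N0 : (0 < N)%N).
Hypothesis stuckQ : forall r (y : int) (k : nat), (y, k) \in Xi ->
  (Q (stuck r N y k t) <= (eta ^+ 2)%:E)%E.

(** On the event, the [M] concatenated paths weigh at most [A0 + B0] in total, so the rays weigh at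
    most [A0] or the strips at most [B0]. The two cases are bounded separately, with parameters
    [theta] and [lam]. *)
Lemma upper_prob (n K J M : nat) (T A0 B0 theta : R) :
  (n = K + J * N)%N -> (4 * N * M <= K)%N -> 0 <= theta ->
  M%:R * T <= A0 + B0 ->
  (Q (below n T) <=
   (expR (theta * A0 + theta ^+ 2 / 2 * (M * \sum_(k < K) crowd M k)%:R) +
    expR (lam * B0) * layer_rate N t lam eta ^+ (J * M))%:E)%E.
Proof.
move=> nE NMK th0 MT; pose c i := ray_at M i K.
have cX i : (c i, K) \in Xi.
  by rewrite /in_mem /= /Xi /c /ray_at /=; move: (_ %/ _)%N => a; lia.
have cS i j : (i < j)%N -> (j < M)%N -> (4 * N)%:Z < c j - c i.
  move=> ij jM; have M0 : (0 < M)%N by apply: leq_ltn_trans jM.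
  (* As [K / M >= 4 N], ray ends differ by at least [4 N] right steps, that is by [8 N] in
     position. *)
  have : (K * i %/ M + 4 * N <= K * j %/ M)%N.
    rewrite -[X in (_ + X)%N](mulnK _ M0) -divnDMl// ?mulnK//.
    apply: leq_div2r; apply: (@leq_trans (K * i + K)%N).
      by rewrite leq_add2l.
    by rewrite -mulnSr leq_mul2l ij orbT.
  rewrite /c /ray_at; move: (K * i %/ M)%N (K * j %/ M)%N => a b; lia.
pose A w := \sum_(e <- fan M K) w e : R.
pose B w := \sum_(i < M) weight (c i) K (walk N t J (c i) (c i) K w) w : R.
have AE w : A w = \sum_(i < M) weight 0 0 (ray M i K) w.
  rewrite /A /fan big_flatten big_map 
    -(big_mkord xpredT (fun i => weight 0 0 (ray M i K) w)).
  by rewrite /index_iota subn0; apply: eq_bigr => i _; rewrite weightE.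
set S := below n T.
have SAB w : S w -> A w + B w <= A0 + B0.
  move=> Sw; apply: le_trans MT; rewrite AE -big_split /=.
  apply: (@le_trans _ _ (\sum_(i < M) T)); last first.
    by rewrite sumr_const card_ord mulr_natl.
  apply: ler_sum => i _.
  have := Sw (ray M i K ++ walk N t J (c i) (c i) K w).
  rewrite weight_cat size_cat size_ray size_walk -nE add0n => /(_ erefl).
  by rewrite (endpoint_ray0 K (ltnW (ltn_ord i))) => h; exact: h.
pose f (w : conf) := ((expR (theta * A0))%:E * (expR (- theta * A w))%:E)%E.
pose g (w : conf) := ((expR (lam * B0))%:E *
  (\prod_(i < M) walk_exp N t lam J (c i) (c i) K w))%E.
have nA : nnmeas (fun w : conf => (expR (- theta * A w))%:E).
  apply: nnmeas_EFin => [|w]; last exact: expR_ge0.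
  apply: (eq_measurable_fun (fun w : conf =>
      expR (\sum_(e <- fan M K) - theta * w e))) => [w _|].
    by rewrite -mulr_sumr.
  by apply: measurable_expR_sum; exact: fan_E.
have nB : nnmeas (fun w : conf =>
    \prod_(i < M) walk_exp N t lam J (c i) (c i) K w)%E.
  apply: (@nnmeas_prod R M (fun i => walk_exp N t lam J (c i) (c i) K)) => i.
  exact: nnmeas_walk_exp.
have mS : measurable S by exact: measurable_below.
have [mA A_0] := nA; have [mB B_0] := nB.
have f0 w : (0 <= f w)%E by rewrite mule_ge0// lee_fin expR_ge0.
have g0 w : (0 <= g w)%E by rewrite mule_ge0// lee_fin expR_ge0.
have mf : measurable_fun setT f by exact: emeasurable_funM.
have mg : measurable_fun setT g by exact: emeasurable_funM.
have prodE w : (\prod_(i < M) walk_exp N t lam J (c i) (c i) K w =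
    (expR (- lam * B w))%:E)%E.
  rewrite /B mulr_sumr; elim: (M) => [|L IH]; first by rewrite !big_ord0 expR0.
  by rewrite !big_ord_recr /= IH expRD EFinM.
have Sfg w : ((\1_S w)%:E <= f w + g w)%E.
  case: (pselect (S w)) => Sw; last by rewrite indicE memNset// adde_ge0.
  rewrite indicE mem_set//=; have := SAB w Sw.
  have [AA _|AA AB] := leP (A w) A0.
    rewrite (@le_trans _ _ (f w))//; last by rewrite leeDl.
    rewrite /f -EFinM -expRD lee_fin -[leLHS]expR0 ler_expR mulNr subr_ge0.
    exact: ler_wpM2l.
  rewrite (@le_trans _ _ (g w))//; last by rewrite leeDr.
  rewrite /g prodE -EFinM -expRD lee_fin -[leLHS]expR0 ler_expR mulNr subr_ge0.
  by apply: ler_wpM2l => //; lra.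
rewrite -(integral1E Q mS).
apply: (@le_trans _ _ (\int[Q]_w (f w + g w))%E).
  apply: ge0_le_integral => //.
    by apply/measurable_EFinP; exact: measurable_indic.
  exact: emeasurable_funD.
rewrite ge0_integralD// EFinD leeD//.
  rewrite ge0_integralZl_EFin ?expR_ge0// integral_expR_multisum//; last exact: fan_E.
  rewrite -EFinM lee_fin -expRD ler_expR lerD2l sqrrN ler_wpM2l//.
    by rewrite divr_ge0// sqr_ge0.
  by rewrite -natr_sum ler_nat; exact: sum_count_fan.
rewrite ge0_integralZl_EFin ?expR_ge0// EFinM lee_pmul2l//.
  by apply: integral_strips => // i j /andP[]; exact: cS.
by rewrite lte_fin expR_gt0.
Qed.

End upper_bound.

(** * Harmonic sums and the dimensions of the strips *)

Section harmonic.
Context {R : realType}.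

Lemma expR1_le4 : expR 1 <= 4 :> R.
Proof.
have h : 2^-1 <= expR (- 2^-1) :> R by have := expR_ge1Dx (- 2^-1 : R); lra.
have -> : expR 1 = (expR (- 2^-1))^-1 ^+ 2 :> R.
  by rewrite -expRN opprK -expRM_natl; congr expR; rewrite mulfV.
have h2 : (expR (- 2^-1 : R))^-1 <= 2.
  by rewrite -[leRHS]invrK lef_pV2 ?posrE ?expR_gt0.
have h0 : 0 <= (expR (- 2^-1 : R))^-1 by rewrite invr_ge0 expR_ge0.
by nra.
Qed.

Definition harmonic_sum n : R := \sum_(k < n) (k.+1%:R)^-1.

Lemma ln_le_sub1 (x : R) : 0 < x -> ln x <= x - 1.
Proof.
move=> x0; rewrite -[leRHS]expRK ler_ln ?posrE ?expR_gt0//.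
by apply: le_trans (expR_ge1Dx _); rewrite addrC subrK.
Qed.

Lemma harmonic_sum_ge n : ln (n.+1%:R) <= harmonic_sum n.
Proof.
elim: n => [|n IH]; first by rewrite ln1 /harmonic_sum big_ord0.
rewrite /harmonic_sum big_ord_recr /= -/(harmonic_sum n).
have n1 : (0 : R) < n.+1%:R by rewrite ltr0n.
have n2 : (0 : R) < n.+2%:R by rewrite ltr0n.
have := ln_le_sub1 (divr_gt0 n2 n1); rewrite ln_div ?posrE//.
have -> : n.+2%:R / n.+1%:R - 1 = n.+1%:R^-1 :> R.
  have -> : n.+2%:R = 1 + n.+1%:R :> R by rewrite nat1r.
  by rewrite mulrDl divff ?gt_eqF// mul1r addrK.
rewrite lerBlDr => h; apply: (le_trans h); rewrite addrC. exact: lerD.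
Qed.

Lemma harmonic_sum_le n : harmonic_sum n.+1 <= 1 + ln (n.+1%:R).
Proof.
elim: n => [|n IH]; first by rewrite ln1 /harmonic_sum big_ord1 invr1 addr0.
rewrite /harmonic_sum big_ord_recr /= -/(harmonic_sum n.+1).
have n1 : (0 : R) < n.+1%:R by rewrite ltr0n.
have n2 : (0 : R) < n.+2%:R by rewrite ltr0n.
have := ln_le_sub1 (divr_gt0 n1 n2); rewrite ln_div ?posrE//.
have -> : n.+1%:R / n.+2%:R - 1 = - n.+2%:R^-1 :> R.
  have -> : n.+1%:R = n.+2%:R - 1 :> R by rewrite -[n.+2%:R]natr1 addrK.
  by rewrite mulrBl divff ?gt_eqF// mul1r addrC addrA addNr add0r.
rewrite lerBlDr -lerBlDl opprK => h.
by rewrite (le_trans (lerD IH (lexx _)))// -addrA lerD2l.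
Qed.

End harmonic.

Lemma sum_crowd_le {R : realType} (M K : nat) : (0 < K)%N ->
  (\sum_(k < K) crowd M k)%:R <= M%:R + K%:R + M%:R * (1 + ln K%:R) :> R.
Proof.
case: K => // K _; rewrite big_ord_recl /= natrD -addrA lerD2l.
apply: (@le_trans _ _ (K%:R + M%:R * harmonic_sum K)).
  rewrite natr_sum /harmonic_sum mulr_sumr.
  have -> : K%:R = \sum_(k < K) (1 : R) by rewrite sumr_const card_ord.
  rewrite -big_split /=; apply: ler_sum => k _.
  rewrite -nat1r lerD2l ler_pdivlMr ?ltr0n//.
  by rewrite -natrM ler_nat leq_divM.
apply: lerD; first by rewrite ler_nat.
apply: ler_wpM2l => //; case: K => [|K].
  by rewrite /harmonic_sum big_ord0 ln1 addr0.
apply: (le_trans (harmonic_sum_le _)); rewrite lerD2l ler_ln ?posrE ?ltr0n//.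
by rewrite ler_nat.
Qed.

(** [K] absorbs all rounding, so [n = K + J * N] exactly. A large [A] makes the ray stage a fraction
    at most [5 / A] of the path, while [M] and [J] remain of order [n]. *)
Lemma strip_dimensions (n N A : nat) :
  (0 < N)%N -> (8 <= A)%N -> (2 * N * A <= n)%N -> (4 * N <= n)%N ->
  let M := (n %/ (N * A))%N in
  let J := ((n - 4 * N * M) %/ N)%N in
  let K := (n - J * N)%N in
  [/\ (n = K + J * N)%N, (4 * N * M <= K)%N, (K < 4 * N * M + N)%N, (0 < M)%N &
   [/\ (n <= M * (2 * N * A))%N, (n <= J * (4 * N))%N, (K * A <= 5 * n)%N &
       (K <= M * (5 * N))%N]].
Proof.
move=> N0 A8 nNA n4N M J K.
have NA0 : (0 < N * A)%N by rewrite muln_gt0 N0; lia.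
have M1 : (0 < M)%N.
  by rewrite divn_gt0//; apply: leq_trans nNA; rewrite -mulnA leq_pmull.
have MA : (M * (N * A) <= n)%N by exact: leq_divM.
have MA' : (n < M.+1 * (N * A))%N by exact: ltn_ceil.
have JN : (J * N <= n - 4 * N * M)%N by exact: leq_divM.
have JN' : (n - 4 * N * M < J.+1 * N)%N by exact: ltn_ceil.
have NM8 : (8 * (N * M) <= n)%N.
  apply: leq_trans MA; rewrite [leqRHS]mulnA [leqRHS]mulnC [(M * N)%N]mulnC.
  by rewrite leq_mul2r A8 orbT.
have e1 : (4 * N * M = 4 * (N * M))%N by rewrite mulnA.
have nE : (n = K + J * N)%N.
  by rewrite subnK// (leq_trans JN)// leq_subr.
have KM : (4 * N * M <= K)%N.
  by move: JN nE NM8; rewrite e1; move: (N * M)%N (J * N)%N => a b; lia.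
have KM' : (K < 4 * N * M + N)%N.
  move: JN' nE NM8; rewrite e1 mulSn; move: (N * M)%N (J * N)%N => a b; lia.
split=> //; split.
- rewrite (_ : M * (2 * N * A) = M * (N * A) + M * (N * A))%N; last first.
    by rewrite -mulnDr -[(2 * N * A)%N]mulnA mul2n addnn.
  by rewrite mulSn in MA'; rewrite ltnW// (leq_trans MA')// leq_add2r leq_pmull.
- rewrite mulnCA; move: JN' nE NM8 n4N; rewrite e1 mulSn.
  by move: (N * M)%N (J * N)%N => a b; lia.
- apply: (@leq_trans ((4 * N * M + N) * A)); first by rewrite leq_mul2r ltnW ?orbT.
  rewrite mulnDl -!mulnA [(N * (M * A))%N]mulnCA.
  move: MA nNA; rewrite -mulnA.
  by move: (M * (N * A))%N (N * A)%N => a b; lia.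
apply: leq_trans (ltnW KM') _; rewrite mulnCA [(M * N)%N]mulnC e1.
have : (N <= N * M)%N by rewrite leq_pmulr.
by move: (N * M)%N => a; lia.
Qed.

(** * Choice of the parameters for the upper bound *)

Section upper_asymptotics.
Context {R : realType}.
Local Notation conf := (@config R (vertex * vertex)%type E).
Local Notation gam := (@std_normal R).
Context (Q : probability conf R) (mu : R).
Hypothesis resampleQ : forall e (f : conf -> \bar R), E e -> nnmeas f ->
  (\int[Q]_x f x = \int[Q]_x resample gam e f x)%E.
Hypothesis lln_below : forall e d : R, 0 < e -> 0 < d ->
  exists n0 : nat, forall n, (n0 <= n)%N ->
  (Q (below n ((mu - e) * n%:R)) <= d%:E)%E.

Lemma upper_asymptotics (eps : R) : 0 < eps ->
  exists2 c : R, 0 < c & exists n0 : nat, forall n, (n0 <= n)%N ->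
  (Q (below n ((mu - eps) * n%:R)) <=
   (expR (- c * n%:R ^+ 2 / ln n%:R))%:E)%E.
Proof.
(* The budget [8 e]: the strips may lose [3 e], the rays lose [e], and the [K] steps missing from
   the strips cost at most [4 e]. *)
move=> eps0; pose e := eps / 8; have e0 : 0 < e by rewrite divr_gt0.
pose gap := expR (- (mu - 2 * e)) - expR (- (mu - e)).
have gap0 : 0 < gap by rewrite subr_gt0 ltr_expR; lra.
have x20 : 0 < expR 2 + 1 :> R by rewrite addr_gt0 ?expR_gt0.
(* Chosen to make the stuck part of [layer_rate] at most [gap]. It must precede [N], which depends
   on it; with [lam] equal to [1 / N] the moment is [expR (2 / N)], at most [expR 2] for every
   [N]. *)
pose eta := 2 * gap / (expR 2 + 1).
have eta0 : 0 < eta by rewrite divr_gt0// mulr_gt0.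
have [n1 n1P] := lln_below e0 (exprn_gt0 4 eta0).
pose N := n1.+1; have N0 : (0 < N)%N by [].
have N0' : (0 : R) < N%:R by rewrite ltr0n.
have N1' : (1 : R) <= N%:R by rewrite ler1n.
pose t := (mu - e) * N%:R; pose lam : R := N%:R^-1.
have lam0 : 0 <= lam by rewrite invr_ge0 ltW.
have stuckQ r (y : int) (k : nat) : (y, k) \in Xi ->
    (Q (stuck r N y k t) <= (eta ^+ 2)%:E)%E.
  move=> yk; apply: (prob_stuck_le resampleQ) => //; first exact: ltW.
  by apply: n1P; rewrite /N leqnSn.
have rate_le : layer_rate N t lam eta <= expR (- (mu - 2 * e)).
  rewrite /layer_rate /t /lam.
  have -> : - N%:R^-1 * ((mu - e) * N%:R) = - (mu - e).
    by rewrite mulNr mulrCA mulVf ?mulr1// gt_eqF.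
  rewrite -lerBrDl -/gap.
  have -> : gap = eta / 2 * (expR 2 + 1).
    by rewrite /eta mulrAC divfK ?gt_eqF// mulrC mulKf.
  apply: ler_wpM2l; first by rewrite divr_ge0// ltW.
  rewrite lerD2r ler_expR.
  have -> : 2 * N%:R^-1 ^+ 2 * N%:R = 2 * N%:R^-1 :> R by field; rewrite gt_eqF.
  by rewrite -[leRHS]mulr1 ler_wpM2l// invf_le1.
(* Large enough that [K * A <= 5 * n] gives [K * (|mu| + 3 e) <= 4 e n]. *)
pose A := (8 + Num.truncn (5 * (`|mu| + 3 * e) / (4 * e))).+1.
have A0 : (0 : R) < A%:R by rewrite ltr0n.
have A8' : (8 <= A)%N by rewrite /A ltnW// ltnS leq_addr.
have A8 : (8 : R) <= A%:R by rewrite ler_nat.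
have AP : 5 * (`|mu| + 3 * e) <= A%:R * (4 * e).
  rewrite -ler_pdivrMr ?mulr_gt0//; apply: (le_trans (ltW (truncnS_gt _))).
  by rewrite ler_nat /A ltnS leq_addl.
(* The variance of the rays is at most [M^2 (2 + 5 N + ln n)], and [1 <= ln n]. *)
pose C : R := 3 + 5 * N%:R.
have C0 : 0 < C by rewrite /C; lra.
(* The Gaussian rate of the rays, and the rate of the strips, where [M * J] blocks, at least
   [n^2 / (8 N^2 A)] of them, each contribute [e]. *)
pose c' := Num.min (e ^+ 2 / (2 * C)) (e / (8 * N%:R ^+ 2 * A%:R)).
have c'0 : 0 < c'.
  by rewrite lt_min !divr_gt0// ?mulr_gt0 ?exprn_gt0.
(* Halving the rate absorbs the sum of two exponentials once [2 <= x], which the last threshold on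
   [n] ensures. *)
exists (c' / 2); first by rewrite divr_gt0.
exists (maxn 4 (maxn (2 * N * A) (maxn (4 * N) (Num.truncn (2 / c')).+1))).
move=> n; rewrite !geq_max => /and4P[n3 nNA n4N nc].
have n3' : (4 : R) <= n%:R by rewrite ler_nat.
have L1 : 1 <= ln n%:R :> R.
  rewrite -[leLHS]expRK ler_ln ?posrE ?expR_gt0//; last by lra.
  by apply: le_trans n3'; exact: expR1_le4.
have Ln : ln n%:R <= n%:R :> R.
  have n0' : (0 : R) < n%:R by lra.
  by have := ln_le_sub1 n0'; lra.
pose M := (n %/ (N * A))%N.
pose J := ((n - 4 * N * M) %/ N)%N; pose K := (n - J * N)%N.
have [nE KM KM' M1 [Mn Jn KA KMN]] := strip_dimensions N0 A8' nNA n4N.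
rewrite -/M -/J -/K in nE KM KM' M1 Mn Jn KA KMN.
move: Mn Jn KA; rewrite -!(ler_nat R) !natrM => Mn Jn KA.
pose B0 : R := M%:R * (J%:R * N%:R) * (mu - 3 * e).
pose A0' : R := - (M%:R * (e * n%:R)).
pose V : R := M%:R ^+ 2 * (C * ln n%:R).
have V0 : 0 < V.
  by rewrite /V !mulr_gt0// ?exprn_gt0 ?ltr0n//; lra.
(* The minimiser of [theta * A0' + theta ^+ 2 / 2 * V]. *)
pose theta : R := e * n%:R * M%:R / V.
have th0 : 0 <= theta.
  by apply: divr_ge0; [rewrite !mulr_ge0// ltW|exact: ltW].
have TAB : M%:R * ((mu - eps) * n%:R) <= A0' + B0.
  rewrite /A0' /B0 -mulrN -mulrA -mulrDr ler_wpM2l//.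
  have -> : J%:R * N%:R = n%:R - K%:R :> R.
    by rewrite {1}nE natrD natrM addrAC subrr add0r.
  have k1 : K%:R * (mu - 3 * e) <= K%:R * (`|mu| + 3 * e).
    by rewrite ler_wpM2l//; have := ler_norm mu; lra.
  have k2 : K%:R * (`|mu| + 3 * e) <= 4 * e * n%:R.
    have h5 : (0 : R) < 5 * A%:R by rewrite mulr_gt0.
    rewrite -(ler_pM2l h5).
    apply: (@le_trans _ _ ((K%:R * A%:R) * (A%:R * (4 * e)))).
      rewrite [leLHS](_ : _ = K%:R * A%:R * (5 * (`|mu| + 3 * e))); last ring.
      by rewrite ler_wpM2l// mulr_ge0.
    rewrite [leRHS](_ : _ = (5 * n%:R) * (A%:R * (4 * e))); last ring.
    by rewrite ler_wpM2r// !mulr_ge0// ltW.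
  have -> : eps = 8 * e by rewrite /e mulrC divfK.
  by rewrite mulrBl; lra.
have VV : (M * \sum_(k < K) crowd M k)%:R <= V.
  have K0 : (0 < K)%N by apply: leq_trans KM; rewrite !muln_gt0 M1.
  rewrite natrM /V expr2 -mulrA ler_wpM2l//; apply: (le_trans (sum_crowd_le M K0)).
  have KM5 : K%:R <= M%:R * (5 * N%:R) :> R.
    by rewrite -!natrM ler_nat.
  have lK : ln K%:R <= ln n%:R :> R.
    rewrite ler_ln ?posrE ?ltr0n ?ler_nat//; first exact: leq_subr.
    exact: leq_trans n3.
  have M0 : (1 : R) <= M%:R by rewrite ler1n.
  have a1 : M%:R * (1 + ln K%:R) <= M%:R * (1 + ln n%:R) :> R.
    by rewrite ler_wpM2l// lerD2l.
  apply: (@le_trans _ _ (M%:R * (1 + 5 * N%:R + (1 + ln n%:R)))).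
    rewrite [leRHS]mulrDr [X in _ <= X + _]mulrDr mulr1.
    by apply: lerD => //; apply: lerD.
  rewrite ler_wpM2l// /C mulrDl; set L := ln _ in L1 *.
  have : 5 * N%:R * 1 <= 5 * N%:R * L by rewrite ler_wpM2l// mulr_ge0.
  by rewrite mulr1; lra.
have := upper_prob resampleQ lam0 eta0 N0 stuckQ nE KM th0 TAB.
move=> /le_trans; apply; rewrite lee_fin.
set x := c' * n%:R ^+ 2 / ln n%:R.
have first_le : theta * A0' + theta ^+ 2 / 2 *
    (M * \sum_(k < K) crowd M k)%:R <= - x.
  apply: (@le_trans _ _ (theta * A0' + theta ^+ 2 / 2 * V)).
    by rewrite lerD2l ler_wpM2l// divr_ge0// sqr_ge0.
  have Vn0 : V != 0 by rewrite gt_eqF.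
  have M0 : M%:R != 0 :> R by rewrite pnatr_eq0 -lt0n.
  have L0 : ln n%:R != 0 :> R by rewrite gt_eqF//; lra.
  have -> : theta * A0' + theta ^+ 2 / 2 * V = - ((e * n%:R * M%:R) ^+ 2 / (2 * V)).
    by rewrite /theta /A0'; field.
  rewrite lerN2 /V.
  have -> : (e * n%:R * M%:R) ^+ 2 / (2 * (M%:R ^+ 2 * (C * ln n%:R))) =
      e ^+ 2 / (2 * C) * n%:R ^+ 2 / ln n%:R.
    by field; rewrite M0 L0 gt_eqF.
  rewrite /x !ler_wpM2r ?invr_ge0 ?exprn_ge0//; first by lra.
  by rewrite /c' ge_min lexx.
have second_le : lam * B0 - (mu - 2 * e) * (J * M)%:R <= - x.
  have -> : lam * B0 = M%:R * J%:R * (mu - 3 * e).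
    by rewrite /lam /B0; field; rewrite gt_eqF.
  have -> : M%:R * J%:R * (mu - 3 * e) - (mu - 2 * e) * (J * M)%:R =
      - (e * (M%:R * J%:R)) by rewrite natrM; ring.
  rewrite lerN2.
  have nMJ : n%:R ^+ 2 <= M%:R * J%:R * (8 * N%:R ^+ 2 * A%:R) :> R.
    have := ler_pM (ler0n R n) (ler0n R n) Mn Jn.
    by rewrite -expr2 => /le_trans; apply; apply: le_of_eq; ring.
  have p0 : 0 < 8 * N%:R ^+ 2 * A%:R :> R by rewrite !mulr_gt0// exprn_gt0.
  apply: (@le_trans _ _ (c' * n%:R ^+ 2)).
    rewrite /x ler_pdivrMr; last by lra.
    by rewrite -[leLHS]mulr1 ler_wpM2l// mulr_ge0 ?exprn_ge0// ltW.
  apply: (@le_trans _ _ (e / (8 * N%:R ^+ 2 * A%:R) * n%:R ^+ 2)).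
    by rewrite ler_wpM2r ?exprn_ge0// /c' ge_min lexx orbT.
  by rewrite mulrAC -mulrA ler_wpM2l ?(ltW e0)// ler_pdivrMr.
have x2 : 2 <= x.
  have h : 2 <= c' * n%:R.
    rewrite mulrC -ler_pdivrMr//; apply: (le_trans (ltW (truncnS_gt _))).
    by rewrite ler_nat.
  apply: (le_trans h); rewrite /x -mulrA ler_wpM2l ?(ltW c'0)//.
  rewrite ler_pdivlMr; last by lra.
  by rewrite expr2 ler_wpM2l.
apply: (@le_trans _ _ (expR (- x) + expR (- x))).
  rewrite lerD ?ler_expR//.
  apply: (@le_trans _ _ (expR (lam * B0) * expR (- (mu - 2 * e)) ^+ (J * M))).
    rewrite ler_wpM2l ?expR_ge0// lerXn2r ?nnegrE ?expR_ge0//.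
    exact: layer_rate_ge0.
  rewrite -expRM_natl -expRD ler_expR; apply: le_trans second_le.
  by rewrite lerD2l mulrN lerN2 mulrC.
have -> : - (c' / 2) * n%:R ^+ 2 / ln n%:R = - x + x / 2.
  by rewrite /x; field; rewrite gt_eqF//; lra.
rewrite expRD -mulr2n -[leLHS]mulr_natr ler_wpM2l ?expR_ge0//.
have x1 : 1 <= x / 2 by lra.
by have := expR_ge1Dx (x / 2); lra.
Qed.

End upper_asymptotics.

(** * The lower bound *)

Section quadrant.
Context {R : realType}.
Local Notation conf := (@config R (vertex * vertex)%type E).
Local Notation gam := (@std_normal R).
Context (Q : probability conf R).
Hypothesis resampleQ : forall e (f : conf -> \bar R), E e -> nnmeas f ->
  (\int[Q]_x f x = \int[Q]_x resample gam e f x)%E.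

Lemma measurable_coord_le e (x : R) : E e ->
  measurable [set w : conf | w e <= x].
Proof.
move=> Ee; rewrite -[X in measurable X]setTI.
rewrite [X in _ `&` X](_ : _ = (fun w : conf => w e) @^-1` [set` `]-oo, x]]).
  exact: (measurable_coord Ee).
by apply/seteqP; split=> w /=; rewrite in_itv.
Qed.

Lemma coord_law e (x : R) : E e ->
  Q [set w | w e <= x] = normal_prob 0 1 [set y | y <= x].
Proof.
move=> Ee; have mA := measurable_coord_le x Ee.
have mB : measurable [set y : R | y <= x].
  by rewrite -set_itvNyc; exact: measurable_itv.
rewrite -(integral1E Q mA) (resampleQ Ee (nnmeas_indic mA)).
rewrite -[RHS]std_normalE -(setIT [set y | y <= x]) -integral_indic//.
transitivity (\int[Q]_w (\int[std_normal]_y (\1_[set y : R | y <= x] y)%:E))%E.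
  apply: eq_integral => w _; apply: eq_integral => y _.
  rewrite !indicE; congr (nat_of_bool _)%:R%:E.
  by apply: (congr1 asbool); rewrite /= /upd eqxx.
rewrite integral_cst//= -[RHS]mule1; congr (_ * _)%E.
exact: probability_setT.
Qed.

Definition quadrant (L : seq (vertex * vertex)) (a : vertex * vertex -> R) :
  set conf := [set w | all (fun e => w e <= - a e) L].

Lemma measurable_quadrant L a : {in L, forall e, E e} ->
  measurable (quadrant L a).
Proof.
rewrite /quadrant; elim: L => [|e L IH] LE /=.
  by rewrite [X in measurable X](_ : _ = setT)//; apply/seteqP; split.
rewrite [X in measurable X](_ : _ = [set w | w e <= - a e] `&`
    [set w : conf | all (fun e => w e <= - a e) L]); last first.
  by apply/seteqP; split=> w /= => [/andP[]|[-> ->]].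
apply: measurableI.
  by apply: measurable_coord_le; apply: LE; rewrite inE eqxx.
by apply: IH => i iL; apply: LE; rewrite inE iL orbT.
Qed.

Lemma depends_quadrant L a : depends_on [set` L] (quadrant L a).
Proof.
move=> w w' ww; congr is_true; apply: eq_in_all => e eL.
by rewrite ww.
Qed.

(* Repetitions in [L] only make the lower bound worse. *)
Lemma quadrant_ge (C : R) L a : 0 <= C ->
  (forall x : R, 1 <= x ->
    ((expR (- C * x ^+ 2))%:E <= normal_prob 0 1 [set y : R | (y <= - x)%R])%E) ->
  {in L, forall e, E e} -> {in L, forall e, 1 <= a e} ->
  ((expR (- C * \sum_(e <- L) a e ^+ 2))%:E <= Q (quadrant L a))%E.
Proof.
move=> C0 tail; elim: L => [|e L IH] LE La.
  rewrite big_nil mulr0 expR0 (_ : quadrant _ _ = setT).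
    by apply: le_of_eq; apply: esym; exact: probability_setT.
  by apply/seteqP; split.
have Ee : E e by apply: LE; rewrite inE eqxx.
have LE' : {in L, forall e, E e}.
  by move=> i iL; apply: LE; rewrite inE iL orbT.
have {}IH : ((expR (- C * \sum_(e <- L) a e ^+ 2))%:E <= Q (quadrant L a))%E.
  by apply: IH => // i iL; apply: La; rewrite inE iL orbT.
rewrite big_cons mulrDr expRD.
case: (boolP (e \in L)) => eL.
  rewrite (_ : quadrant (e :: L) a = quadrant L a).
    apply: le_trans IH; rewrite lee_fin ler_piMl ?expR_ge0//.
    by rewrite -[leRHS]expR0 ler_expR mulNr oppr_le0 mulr_ge0 ?sqr_ge0.
  apply/seteqP; split=> w /= => [/andP[]//|h].
  by apply/andP; split=> //; exact: (allP h).
have mA := measurable_coord_le (- a e) Ee.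
have mB := measurable_quadrant a LE'.
have -> : Q (quadrant (e :: L) a) =
    (Q [set w | (w e <= - a e)%R] * Q (quadrant L a))%E.
  rewrite (_ : quadrant (e :: L) a = [set w | w e <= - a e] `&` quadrant L a).
    rewrite -!integral1E//; last exact: measurableI.
    rewrite -(integral_indep resampleQ (l := [:: e]) (S := [set` L])).
    - by apply: eq_integral => w _; rewrite -EFinM indicI.
    - by move=> i; rewrite inE => /eqP ->.
    - exact: nnmeas_indic.
    - exact: nnmeas_indic.
    - move=> w w' ww; rewrite !indicE; congr (nat_of_bool _)%:R%:E.
      by apply: (congr1 asbool); rewrite /= ww//= inE.
    - move=> w w' ww; rewrite !indicE; congr (nat_of_bool _)%:R%:E.
      by apply: (congr1 asbool); exact: depends_quadrant.
    - by move=> i; rewrite inE => /eqP -> /=; apply/negP.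
  by apply/seteqP; split=> w /= => [/andP[]|[h1 h2]] //; apply/andP.
rewrite EFinM lee_pmul// coord_law//; apply: tail.
by apply: La; rewrite inE eqxx.
Qed.

End quadrant.

(** * Edges that paths from the origin can use *)

Section cone.
Implicit Types (k m : nat).

Definition cone m : seq (vertex * vertex) :=
  flatten [seq [seq edge ((2 * i)%N%:Z - k%:Z) k b |
                 i <- iota 0 k.+1, b <- [:: true; false]] | k <- iota 0 m].

Lemma cone_E m : {in cone m, forall e, E e}.
Proof.
move=> e /flatten_mapP[k _ /allpairsP[[i b] [_ _ ->]]].
by apply/E_edge; rewrite /in_mem /= /Xi /=; lia.
Qed.

Lemma cone_level m e : e \in cone m -> (e.1.2 < m)%N.
Proof.
by move=> /flatten_mapP[k + /allpairsP[[i b] [_ _ ->]]]; rewrite mem_iota.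
Qed.

Lemma mem_cone m (y : int) k b : (y, k) \in Xi -> (k < m)%N -> `|y| <= k%:Z ->
  edge y k b \in cone m.
Proof.
move=> yk km yk'; apply/flatten_mapP; exists k; first by rewrite mem_iota.
apply/allpairsP; exists (`|(y + k%:Z)%R|./2, b); split.
- by rewrite mem_iota [(_, _).1]/=; lia.
- by case: b; rewrite !inE.
rewrite [(_, _).1]/= [(_, _).2]/=; congr edge.
by move: yk; rewrite /in_mem /= /Xi /=; lia.
Qed.

Lemma sum_cone (R : realType) m (F : nat -> R) :
  \sum_(e <- cone m) F e.1.2 = \sum_(k < m) 2 * (k.+1%:R * F k).
Proof.
rewrite /cone big_flatten big_map -(big_mkord xpredT (fun k => 2 * (k.+1%:R * F k))).
rewrite /index_iota subn0; apply: eq_bigr => k _.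
rewrite big_allpairs_dep (eq_bigr (fun=> F k + F k)) => [|i _]; last first.
  by rewrite !big_cons big_nil /= addr0.
by rewrite big_const_seq count_predT size_iota iter_addr_0 -mulr_natl; ring.
Qed.

Lemma path_edges_cone (m : nat) (s : seq bool) e : e \in path_edges 0 0 s ->
  (e.1.2 < m)%N -> e \in cone m.
Proof.
have H x k : (x, k) \in Xi -> `|x| <= k%:Z -> e \in path_edges x k s ->
    exists y j b, [/\ e = edge y j b, (y, j) \in Xi & `|y| <= j%:Z].
  elim: s x k => //= b s IH x k xk xk'; rewrite inE => /orP[/eqP ->|].
    by exists x, k, b.
  apply: IH; first exact: Xi_step.
  by move: xk'; rewrite /step; case: b; lia.
move=> es em; have [//|//|y [j [b [ejb yj yj']]]] := H 0 0%N _ _ es.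
by move: em; rewrite ejb /= => jm; exact: mem_cone.
Qed.

End cone.

Lemma path_edges_lt (x : int) k (s : seq bool) e : e \in path_edges x k s ->
  (e.1.2 < k + size s)%N.
Proof.
elim: s x k => //= b s IH x k; rewrite inE addnS -addSn => /orP[/eqP ->|/IH//].
by rewrite /= leq_addr.
Qed.

Lemma sum_path_edges (R : realType) (x : int) k (s : seq bool) (F : nat -> R) :
  \sum_(e <- path_edges x k s) F e.1.2 = \sum_(j <- iota k (size s)) F j.
Proof.
by elim: s x k => [|b s IH] x k /=; rewrite ?big_nil// !big_cons IH.
Qed.

Lemma size_cone m : size (cone m) = (m * m.+1)%N.
Proof.
rewrite /cone size_flatten /shape -map_comp sumnE big_map.
rewrite (eq_bigr (fun k => k.+1 * 2)%N) => [|k _]; last first.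
  by rewrite /comp size_allpairs size_iota.
elim: m => [|m IH]; first by rewrite big_nil.
by rewrite -addn1 iotaD big_cat /= IH big_seq1 add0n; lia.
Qed.

(** A power of two suffices. The left inequality leaves room [n / m >= m^2] per edge below level
    [m]; the right one keeps [ln m] comparable with [ln n]. *)
Lemma cube_root_exists n : (0 < n)%N -> exists2 m, (0 < m)%N & (m ^ 3 <= n < 8 * m ^ 3)%N.
Proof.
move=> n0; have /andP[h1 h2] := trunc_log_bounds (isT : 1 < 2)%N n0.
pose q := (trunc_log 2 n %/ 3)%N; exists (2 ^ q)%N; first by rewrite expn_gt0.
rewrite -expnM; apply/andP; split.
  by apply: leq_trans h1; rewrite leq_exp2l// leq_divM.
apply: (leq_trans h2); rewrite -[8%N]/(2 ^ 3)%N -expnD leq_exp2l//.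
by rewrite -mulSn ltn_ceil.
Qed.

(** * Forcing the cone while the rest of the path stays typical *)

Section lower_asymptotics.
Context {R : realType}.
Local Notation conf := (@config R (vertex * vertex)%type E).
Local Notation gam := (@std_normal R).
Context (Q : probability conf R) (mu : R).
Hypothesis resampleQ : forall e (f : conf -> \bar R), E e -> nnmeas f ->
  (\int[Q]_x f x = \int[Q]_x resample gam e f x)%E.

Hypothesis lln_above : forall e d : R, 0 < e -> 0 < d ->
  exists n0 : nat, forall n, (n0 <= n)%N ->
  ((1 - d)%:E <= Q (below n ((mu + e) * n%:R)))%E.

Definition tail_below m n (T : R) : set conf :=
  [set w | all (fun s => weight (endpoint 0 (take m s)) m (drop m s) w <= T)
     (bitseqs n)].

Lemma measurable_tail_below m n T : (m <= n)%N -> measurable (tail_below m n T).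
Proof.
move=> mn; apply: measurable_all_bits => s; rewrite mem_bitseqs => /eqP sn.
apply: measurable_weight_le; have := @Xi_endpoint 0 0 (take m s) isT.
by rewrite add0n size_takel// sn.
Qed.

Lemma depends_tail_below m n T : (m <= n)%N ->
  depends_on [set e : vertex * vertex | (m <= e.1.2)%N] (tail_below m n T).
Proof.
move=> mn w w' ww; congr is_true; apply: eq_in_all => s _.
rewrite !weightE; congr (_ <= _); apply: eq_big_seq => e es.
by apply: ww; exact: path_edges_level es.
Qed.

Lemma has_le_prob (L : seq (vertex * vertex)) (x : R) :
  {in L, forall e, E e} ->
  measurable [set w : conf | has (fun e => w e <= - x) L] /\
  (Q [set w : conf | has (fun e => (w e <= - x)%R) L] <=
   (size L)%:R%:E * (expR (2^-1 - x))%:E)%E.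
Proof.
elim: L => [|e L IH] LE /=.
  rewrite [X in measurable X](_ : _ = set0); last by apply/seteqP; split.
  by rewrite [X in Q X](_ : _ = set0) ?measure0 ?mul0e//; apply/seteqP; split.
have Ee : E e by apply: LE; rewrite inE eqxx.
have [|mL QL] := IH; first by move=> i iL; apply: LE; rewrite inE iL orbT.
have me := measurable_coord_le (- x) Ee.
rewrite (_ : [set w : conf | _] = [set w | w e <= - x] `|`
    [set w : conf | has (fun e => w e <= - x) L]); last first.
  apply/seteqP; split=> w /= => [/orP[]|[->//|->]]; [by left|by right|].
  by rewrite orbT.
split; first exact: measurableU.
apply: le_trans (measureU2 _ _ _) _ => //.
rewrite -nat1r EFinD muleDl// mul1e leeD//.
apply: le_trans (normal_prob_le x); apply: le_of_eq; exact: coord_law.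
Qed.

(** Unless some edge of the cone is at most [- x], the first [m] steps weigh at least [- m x], so
    removing them raises the bound by at most [m x]. This transfers the estimate for paths from the
    origin to their tails. *)
Lemma tail_below_ge m n (T x : R) : (m <= n)%N ->
  (Q (below n T) <= Q (tail_below m n (T + m%:R * x)) +
    (m * m.+1)%:R%:E * (expR (2^-1 - x))%:E)%E.
Proof.
move=> mn; pose H := [set w : conf | has (fun e => w e <= - x) (cone m)].
have mT := measurable_tail_below (T + m%:R * x) mn.
have [mH QH] : measurable H /\
    (Q H <= (size (cone m))%:R%:E * (expR (2^-1 - x))%:E)%E.
  exact: has_le_prob (@cone_E m).
apply: (@le_trans _ _ (Q (tail_below m n (T + m%:R * x) `|` H))).
  apply: le_measure; rewrite ?inE; [exact: measurable_below|exact: measurableU|].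
  move=> w wT; case: (boolP (has (fun e => w e <= - x) (cone m))) => hw.
    by right.
  left; apply/allP => s; rewrite mem_bitseqs => /eqP sn.
  have := wT s sn; rewrite -{1}(cat_take_drop m s) weight_cat add0n.
  rewrite size_takel ?sn// => h.
  suff : - (m%:R * x) <= weight 0 0 (take m s) w by move: h; lra.
  rewrite weightE -mulrN.
  apply: (@le_trans _ _ (\sum_(e <- path_edges 0 0 (take m s)) - x)).
    rewrite big_const_seq count_predT size_path_edges size_takel ?sn//.
    by rewrite iter_addr_0 mulr_natl.
  rewrite big_seq [leRHS]big_seq; apply: ler_sum => e es; apply: ltW.
  rewrite ltNge; apply/negP => ex; move/negP : hw; apply; apply/hasP.
  exists e => //; apply: (path_edges_cone es).
  have := path_edges_lt es; by rewrite add0n size_takel ?sn.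
apply: le_trans (measureU2 _ _ _) _ => //.
by rewrite leeD2l//; move: QH; rewrite size_cone.
Qed.

Lemma below_ge m n (T : R) (a : nat -> R) : (m <= n)%N ->
  (Q (quadrant (cone m) (fun e => a e.1.2)) * Q (tail_below m n T) <=
   Q (below n (T - \sum_(k < m) a k)))%E.
Proof.
move=> mn; set B := quadrant _ _; set C := tail_below m n T.
have mB : measurable B by apply: measurable_quadrant; exact: cone_E.
have mC : measurable C by exact: measurable_tail_below.
have -> : (Q B * Q C = Q (B `&` C))%E.
  rewrite -!integral1E//; last exact: measurableI.
  rewrite -(integral_indep resampleQ (l := cone m)
    (S := [set e : vertex * vertex | (m <= e.1.2)%N])).
  - by apply: eq_integral => w _; rewrite -EFinM indicI.
  - exact: cone_E.
  - exact: nnmeas_indic.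
  - exact: nnmeas_indic.
  - move=> w w' ww; rewrite !indicE; congr (nat_of_bool _)%:R%:E.
    by apply: (congr1 asbool); exact: depends_quadrant.
  - move=> w w' ww; rewrite !indicE; congr (nat_of_bool _)%:R%:E.
    by apply: (congr1 asbool); exact: depends_tail_below ww.
  - by move=> e /cone_level + /=; rewrite ltnNge => /negP.
apply: le_measure; rewrite ?inE; [exact: measurableI|exact: measurable_below|].
move=> w [wB wC] s sn.
rewrite -{1}(cat_take_drop m s) weight_cat add0n size_takel ?sn//.
rewrite addrC lerD//; first by apply: (allP wC); rewrite mem_bitseqs sn.
rewrite weightE; apply: (@le_trans _ _
  (\sum_(e <- path_edges 0 0 (take m s)) - a e.1.2)).
  rewrite big_seq [leRHS]big_seq; apply: ler_sum => e es.
  apply: (allP wB); apply: (path_edges_cone es).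
  by have := path_edges_lt es; rewrite add0n size_takel ?sn.
rewrite sumrN lerN2 (sum_path_edges 0 0 (take m s) a) size_takel ?sn//.
by rewrite -(big_mkord xpredT) /index_iota subn0.
Qed.

Lemma lower_asymptotics (eps : R) : 0 < eps ->
  exists2 c : R, 0 < c & exists n0 : nat, forall n, (n0 <= n)%N ->
  ((expR (- c * n%:R ^+ 2 / ln n%:R))%:E <=
   Q (below n ((mu - eps) * n%:R)))%E.
Proof.
move=> eps0; have [C C0 tailP] := @normal_prob_ge R.
(* A quarter is lost here and another in [small], leaving probability at least one half for the tail
   event. *)
have [n1 n1P] := lln_above eps0 (divr_gt0 (ltr01) (ltr0n R 4) : 0 < 1 / 4).
pose m0 := (Num.truncn (8 / eps)).+1.
(* [108 = 18 * 6]: the cost is [18 C eps^2 n^2 / H] with [ln n <= 6 H]. The extra [1] pays for the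
   factor one half of the tail. *)
exists (108 * C * eps ^+ 2 + 1).
  by rewrite ltr_wpDl// !mulr_ge0 ?sqr_ge0// ltW.
exists (maxn n1 (maxn 4 (8 * m0 ^ 3))) => n.
rewrite !geq_max => /and3P[n1n n4 nm0].
have n4' : (4 : R) <= n%:R by rewrite ler_nat.
have L0 : 0 < ln n%:R :> R by rewrite ln_gt0//; lra.
have Ln : ln n%:R <= n%:R :> R.
  have n0' : (0 : R) < n%:R by lra.
  by have := ln_le_sub1 n0'; lra.
have [m m1 /andP[mn nm]] := @cube_root_exists n (leq_trans (isT : 0 < 4)%N n4).
have m0m : (m0 < m)%N.
  by have := leq_ltn_trans nm0 nm; rewrite ltn_pmul2l// ltn_exp2r.
have m_n : (m <= n)%N by apply: leq_trans mn; rewrite -{1}(expn1 m) leq_pexp2l.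
have m1' : (1 : R) <= m%:R by rewrite ler1n.
have em : 8 <= eps * m%:R.
  rewrite mulrC -ler_pdivrMr//; apply: (le_trans (ltW (truncnS_gt _))).
  by rewrite ler_nat ltnW.
have mn' : m%:R ^+ 3 <= n%:R :> R by rewrite -natrX ler_nat.
pose H : R := harmonic_sum m.
have H1 : 1 <= H.
  rewrite /H; case: (m) m1 => // k _; rewrite /harmonic_sum big_ord_recl invr1 lerDl.
  by apply: sumr_ge0 => i _; rewrite invr_ge0.
have Hm : H <= m%:R.
  rewrite /H /harmonic_sum -[leRHS]mulr_natr mul1r -[X in _ <= X%:R](card_ord m).
  rewrite -sumr_const; apply: ler_sum => i _.
  by rewrite invf_le1// ler1n.
(* From [n < (2 m)^3] one gets [ln n <= 3 (1 + H)], and [1 <= H]. *)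
have LH : ln n%:R <= 6 * H.
  have h1 : ln n%:R <= ln ((2 * m%:R) ^+ 3) :> R.
    rewrite ler_ln ?posrE ?exprn_gt0 ?mulr_gt0//; try lra.
    by rewrite exprMn -!natrX -natrM ler_nat ltnW.
  apply: (le_trans h1); rewrite lnXn ?mulr_gt0//; try lra.
  rewrite lnM ?posrE//; try lra.
  have h2 : ln 2 <= 1 :> R by have := ln_le_sub1 (ltr0Sn R 1); lra.
  have h3 : ln m%:R <= H.
    apply: le_trans (harmonic_sum_ge m); rewrite ler_ln ?posrE ?ltr0n//.
    by rewrite ler_nat.
  rewrite -[leLHS]mulr_natl.
  lra.
(* The optimal profile, normalised to a total loss of [3 eps n]: the tail is only known to stay
   below [(mu + 2 eps) n]. *)
pose c := 3 * eps * n%:R / H; pose a (k : nat) := c / k.+1%:R.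
have H0 : H != 0 by rewrite gt_eqF//; lra.
have sum_a : \sum_(k < m) a k = 3 * eps * n%:R.
  by rewrite /a -mulr_sumr -/(harmonic_sum m) -/H /c divfK.
(* Makes every shift [a k] with [k < m] at least 1, the range in which the Gaussian lower tail bound
   holds. *)
have cm : m%:R <= c.
  rewrite /c ler_pdivlMr; last by lra.
  apply: (@le_trans _ _ (m%:R * m%:R)); first by rewrite ler_wpM2l.
  apply: (@le_trans _ _ (3 * eps * m%:R ^+ 3)); last first.
    by rewrite ler_wpM2l// mulr_ge0// ltW.
  have -> : 3 * eps * m%:R ^+ 3 = 3 * (eps * m%:R) * (m%:R * m%:R) by ring.
  rewrite -[leLHS]mul1r ler_wpM2r ?mulr_ge0//; lra.
have a1 k : (k < m)%N -> 1 <= a k.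
  move=> km; rewrite /a ler_pdivlMr ?ltr0n// mul1r.
  by apply: le_trans cm; rewrite ler_nat.
have Qquad : ((expR (- C * (2 * c ^+ 2 * H)))%:E <=
    Q (quadrant (cone m) (fun e => a e.1.2)))%E.
  have -> : 2 * c ^+ 2 * H = \sum_(e <- cone m) a e.1.2 ^+ 2.
    rewrite (sum_cone m (fun k => a k ^+ 2)) /H /harmonic_sum mulr_sumr.
    apply: eq_bigr => k _; rewrite /a; field.
    by rewrite addrC natr1 pnatr_eq0.
  apply: (quadrant_ge resampleQ) => //; first exact: ltW.
    exact: cone_E.
  by move=> e /cone_level; exact: a1.
(* Then [m * x = eps * n], the second [eps] in the tail bound, while [x >= eps m^2] makes the union
   bound over the cone small. *)
pose x := eps * n%:R / m%:R.
have Tx : (mu + eps) * n%:R + m%:R * x = (mu + 2 * eps) * n%:R.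
  by rewrite /x; field; rewrite gt_eqF//; lra.
have x_ge : eps * m%:R ^+ 2 <= x.
  rewrite /x ler_pdivlMr; last by lra.
  by rewrite -mulrA -exprSr ler_wpM2l// ltW.
have small : (m * m.+1)%:R * expR (2^-1 - x) <= 1 / 4.
  have e1 : expR (2^-1 - x) <= 4 / expR x.
    rewrite expRD expRN ler_wpM2r ?invr_ge0 ?expR_ge0//.
    by apply: le_trans expR1_le4; rewrite ler_expR; lra.
  have x0 : 0 <= x by apply: le_trans x_ge; rewrite mulr_ge0 ?exprn_ge0// ltW.
  have e2 : 32 * m%:R ^+ 2 <= expR x.
    have := expR_ge1Dxn 1 x0; rewrite (_ : 2`!%:R = 2) // => h.
    have h2 : (eps * m%:R ^+ 2) ^+ 2 <= x ^+ 2.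
      by rewrite lerXn2r ?nnegrE// mulr_ge0 ?exprn_ge0// ltW.
    have h3 : 64 * m%:R ^+ 2 <= (eps * m%:R ^+ 2) ^+ 2.
      have -> : (eps * m%:R ^+ 2) ^+ 2 = (eps * m%:R) ^+ 2 * m%:R ^+ 2 by ring.
      rewrite ler_wpM2r ?exprn_ge0//; nra.
    lra.
  have m2 : 0 < m%:R ^+ 2 :> R by rewrite exprn_gt0//; lra.
  have e3 : expR (2^-1 - x) <= 4 / (32 * m%:R ^+ 2).
    apply: (le_trans e1); rewrite ler_wpM2l// lef_pV2 ?posrE ?expR_gt0//.
    by rewrite mulr_gt0.
  have e4 : (m * m.+1)%:R <= 2 * m%:R ^+ 2 :> R.
    rewrite natrM -natr1; nra.
  apply: (@le_trans _ _ (2 * m%:R ^+ 2 * (4 / (32 * m%:R ^+ 2)))).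
    by rewrite ler_pM// expR_ge0.
  have -> : 2 * m%:R ^+ 2 * (4 / (32 * m%:R ^+ 2)) = 1 / 4 :> R.
    by field; rewrite gt_eqF//; lra.
  exact: lexx.
have Qtail : ((2^-1)%:E <= Q (tail_below m n ((mu + 2 * eps) * n%:R)))%E.
  have := tail_below_ge ((mu + eps) * n%:R) x m_n; rewrite Tx.
  have mT : measurable (tail_below m n ((mu + 2 * eps) * n%:R)).
    exact: measurable_tail_below.
  have := n1P n n1n.
  have qfin : Q (tail_below m n ((mu + 2 * eps) * n%:R)) \is a fin_num.
    exact: fin_num_measure.
  move=> /le_trans h /h {h}; rewrite -(fineK qfin) -EFinM -EFinD !lee_fin.
  by move: small; lra.
have := below_ge ((mu + 2 * eps) * n%:R) a m_n; rewrite sum_a.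
have -> : (mu + 2 * eps) * n%:R - 3 * eps * n%:R = (mu - eps) * n%:R by ring.
apply: le_trans; apply: (@le_trans _ _
  ((expR (- C * (2 * c ^+ 2 * H)))%:E * (2^-1)%:E)%E); last first.
  by rewrite lee_pmul// lee_fin// expR_ge0.
rewrite -EFinM lee_fin.
have y1 : 1 <= n%:R ^+ 2 / ln n%:R :> R.
  by rewrite ler_pdivlMr// mul1r (le_trans Ln)// expr2 ler_peMl//; lra.
have y2 : 2 * c ^+ 2 * H <= 108 * eps ^+ 2 * (n%:R ^+ 2 / ln n%:R).
  have -> : 2 * c ^+ 2 * H = 18 * eps ^+ 2 * n%:R ^+ 2 * H^-1.
    by rewrite /c; field.
  have -> : 108 * eps ^+ 2 * (n%:R ^+ 2 / ln n%:R) =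
      18 * eps ^+ 2 * n%:R ^+ 2 * (6 / ln n%:R) by field; rewrite gt_eqF.
  apply: ler_wpM2l.
    by apply: mulr_ge0; [apply: mulr_ge0 => //; exact: sqr_ge0|exact: sqr_ge0].
  by rewrite ler_pdivlMr// mulrC ler_pdivrMr//; lra.
have half : expR (- (n%:R ^+ 2 / ln n%:R)) <= 2^-1 :> R.
  rewrite expRN lef_pV2 ?posrE ?expR_gt0//.
  by have := expR_ge1Dx (n%:R ^+ 2 / ln n%:R : R); lra.
have -> : - (108 * C * eps ^+ 2 + 1) * n%:R ^+ 2 / ln n%:R =
    - C * (108 * eps ^+ 2 * (n%:R ^+ 2 / ln n%:R)) - n%:R ^+ 2 / ln n%:R.
  by field; rewrite gt_eqF.
rewrite expRD ler_pM ?expR_ge0// ler_expR !mulNr lerN2 ler_wpM2l//.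
exact: ltW.
Qed.

End lower_asymptotics.

(** * Conclusion *)

Section limits.
Context {R : realType}.
Local Open Scope ereal_scope.

Lemma limn_esup_le (u : (\bar R)^nat) (M : \bar R) (n0 : nat) :
  (forall n, (n0 <= n)%N -> u n <= M) -> limn_esup u <= M.
Proof.
move=> uM; rewrite limn_esup_lim; apply: lime_le; first exact: is_cvg_esups.
near=> n; apply: ge_ereal_sup => _ [k /= nk <-]; apply: uM.
by apply: leq_trans nk; near: n; exists n0.
Unshelve. all: by end_near. Qed.

Lemma limn_einf_ge (u : (\bar R)^nat) (M : \bar R) (n0 : nat) :
  (forall n, (n0 <= n)%N -> M <= u n) -> M <= limn_einf u.
Proof.
move=> uM; rewrite /limn_einf leeNr; apply: (@limn_esup_le _ _ n0) => n nn.
by rewrite leeN2; exact: uM.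
Qed.

(** The events that [A k] holds for all [k >= n] increase to an event of probability 1, so
    continuity from below applies. *)
Lemma eventually_prob d (Omega : measurableType d) (P : probability Omega R)
    (A : nat -> set Omega) : (forall n, measurable (A n)) ->
  {ae P, forall w, \forall n \near \oo, A n w} ->
  forall e : R, (0 < e)%R -> exists n0 : nat, forall n, (n0 <= n)%N ->
    (1 - e)%:E <= P (A n).
Proof.
move=> mA aeA e e0.
pose B n := \bigcap_(k in [set k | (n <= k)%N]) A k.
have mB n : measurable (B n) by apply: bigcap_measurable => [|k _] //; exists n => /=.
have mUB : measurable (\bigcup_n B n) by exact: bigcupT_measurable.
have ndB : nondecreasing_seq B.
  apply/nondecreasing_seqP => n; apply/subsetPset => w Bw k /= nk.
  by apply: Bw; rewrite /= ltnW.
have BA n : B n `<=` A n by move=> w; apply => /=.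
have cvgB : P (B n) @[n --> \oo] --> P (\bigcup_n B n).
  exact: nondecreasing_cvg_mu.
have PU : P (\bigcup_n B n) = 1.
  have [N [mN N0 AN]] := aeA.
  apply/eqP; rewrite eq_le probability_le1//=.
  have <- : P (~` N) = 1 by rewrite probability_setC// N0 sube0.
  apply: le_measure; rewrite ?inE//; first exact: measurableC.
  move=> w Nw; have /contrapT [k _ kA] : ~ ~ \forall n \near \oo, A n w.
    by move=> Aw; apply: Nw; exact: AN.
  by exists k => // n; exact: kA.
have [n0 n0P] : exists n0, (1 - e)%:E <= P (B n0).
  apply: contrapT => /forallNP h; move: e0; apply/negP; rewrite -leNgt.
  have : limn (P \o B) <= (1 - e)%:E.
    apply: lime_le; first by apply/cvg_ex; exists (P (\bigcup_n B n)).
    by apply: nearW => n; rewrite leNgt; apply/negP => /ltW; exact: h.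
  by rewrite (cvg_lim _ cvgB)// PU lee_fin; lra.
exists n0 => n n0n; apply: (le_trans n0P); apply: le_measure; rewrite ?inE//.
by move=> w; exact.
Qed.

End limits.

Theorem theorem1p2 (R : realType) (d : measure_display)
    (Omega : measurableType d) (P : probability Omega R)
    (X : (int * nat) * (int * nat) -> {RV P >-> R}) (mu : R)
    (X_indep : mutually_independent E X)
    (X_normal : forall e, E e -> has_law (X e) (normal_prob 0 1))
    (mu_lim : {ae P, forall w,
       (fun n : nat => Z (fun e => X e w) n / n%:R) @ \oo --> mu}) :
  \forall eps \near 0^'+,
    let u := fun n : nat =>
      ((log2 n%:R / n%:R ^+ 2)%:E *
       log2e (P [set w | (Z (fun e => X e w) n <= (mu - eps) * n%:R)%R]))%E in
    (-oo < limn_einf u /\ limn_einf u <= limn_esup u /\ limn_esup u < 0)%E.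
Proof.
pose Q : probability (@config R ((int * nat) * (int * nat))%type E) R :=
  joint_law E X.
have QZ n T : Q (below n T) = P [set w | (Z (fun e => X e w) n <= T)%R].
  by congr (P _); apply/seteqP; split=> w /ZleP.
have mZ n T : measurable [set w | (Z (fun e => X e w) n <= T)%R].
  have := @measurable_joint _ _ _ P _ E X measurableT _ (measurable_below n T).
  rewrite setTI; congr measurable.
  by apply/seteqP; split=> w /ZleP.
have resampleQ e (f : config E -> \bar R) : E e -> nnmeas f ->
    (\int[Q]_x f x = \int[Q]_x resample std_normal e f x)%E.
  exact: joint_law_resample.
have lln_below (e b : R) : 0 < e -> 0 < b ->
  exists n0 : nat, forall n, (n0 <= n)%N ->
  (Q (below n ((mu - e) * n%:R)) <= b%:E)%E.
  move=> e0 b0.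
  pose A n := ~` [set w | Z (fun e => X e w) n <= (mu - e) * n%:R].
  have mA n : measurable (A n) by exact: measurableC.
  have aeA : {ae P, forall w, \forall n \near \oo, A n w}.
    apply: filterS mu_lim => w /cvgrPdist_lt /(_ e e0) cv.
    near=> n; have n0 : (0 : R) < n%:R by rewrite ltr0n; near: n; exists 1%N.
    rewrite /A /= -ler_pdivrMr// => ZA.
    have : `|mu - Z (fun e => X e w) n / n%:R| < e by near: n; exact: cv.
    by rewrite ltr_norml => /andP[]; lra.
  have [n0 n0P] := eventually_prob mA aeA b0.
  exists n0 => n /n0P; rewrite probability_setC// QZ.
  have fp : P [set w | Z (fun e => X e w) n <= (mu - e) * n%:R] \is a fin_num.
    exact: fin_num_measure.
  by rewrite -(fineK fp) -EFinB !lee_fin; lra.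
have lln_above (e b : R) : 0 < e -> 0 < b ->
  exists n0 : nat, forall n, (n0 <= n)%N ->
  ((1 - b)%:E <= Q (below n ((mu + e) * n%:R)))%E.
  move=> e0 b0.
  pose A n := [set w | Z (fun e => X e w) n <= (mu + e) * n%:R].
  have aeA : {ae P, forall w, \forall n \near \oo, A n w}.
    apply: filterS mu_lim => w /cvgrPdist_lt /(_ e e0) cv.
    near=> n; have n0 : (0 : R) < n%:R by rewrite ltr0n; near: n; exists 1%N.
    rewrite /A /= -ler_pdivrMr//.
    have : `|mu - Z (fun e => X e w) n / n%:R| < e by near: n; exact: cv.
    by rewrite ltr_norml => /andP[]; lra.
  have [n0 n0P] := eventually_prob (fun n => mZ n _) aeA b0.
  by exists n0 => n /n0P; rewrite QZ.
near=> eps; have eps0 : 0 < eps by near: eps; exact: nbhs_right_gt.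
have [c c0 [n1 upper]] := upper_asymptotics resampleQ lln_below eps0.
have [c' c'0 [n2 lower]] := lower_asymptotics resampleQ lln_above eps0.
set u := (X in limn_einf X).
have ln20 : 0 < ln 2 :> R by rewrite ln_gt0// ltr1n.
(* Two changes of base, one in [log n] and one in the logarithm of the probability, produce
   [ln 2 ^+ 2]. *)
have uE n : (maxn 2 (maxn n1 n2) <= n)%N ->
    ((- (c' / ln 2 ^+ 2))%:E <= u n <= (- (c / ln 2 ^+ 2))%:E)%E.
  rewrite !geq_max => /and3P[n2' nn1 nn2].
  have := upper n nn1; have := lower n nn2; rewrite QZ /u.
  set p := P _ => pl pu.
  have fp : p \is a fin_num by exact: fin_num_measure.
  have L0 : 0 < ln n%:R :> R by rewrite ln_gt0// ltr1n.
  have n0 : 0 < n%:R ^+ 2 :> R by rewrite exprn_gt0// ltr0n ltnW.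
  move: pl pu; rewrite -(fineK fp) !lee_fin => pl pu.
  (* The lower bound excludes probability 0, where [log2e] would be [-oo]. *)
  have p0 : 0 < fine p by apply: lt_le_trans pl; exact: expR_gt0.
  rewrite /log2e lne_EFin// -!EFinM !lee_fin /log2.
  have pl' : - c' * n%:R ^+ 2 / ln n%:R <= ln (fine p).
    by rewrite -[leLHS]expRK ler_ln ?posrE ?expR_gt0.
  have pu' : ln (fine p) <= - c * n%:R ^+ 2 / ln n%:R.
    by rewrite -[leRHS]expRK ler_ln ?posrE ?expR_gt0.
  pose D := ln n%:R / (n%:R ^+ 2 * ln 2 ^+ 2) : R.
  have D0 : 0 <= D.
    by apply: divr_ge0; [exact: ltW|rewrite mulr_ge0 ?sqr_ge0// ltW].
  have nn0 : n%:R != 0 :> R by rewrite pnatr_eq0; case: (n) n2'.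
  have l20 : ln 2 != 0 :> R by rewrite gt_eqF.
  have -> : ln n%:R / ln 2 / n%:R ^+ 2 * (ln (fine p) * (ln 2)^-1) = D * ln (fine p).
    by rewrite /D; field; rewrite nn0 l20.
  have cE (x : R) : - (x / ln 2 ^+ 2) = D * (- x * n%:R ^+ 2 / ln n%:R).
    by rewrite /D; field; rewrite nn0 l20 gt_eqF.
  by rewrite !cE !ler_wpM2l.
split; [|split].
- apply: (@lt_le_trans _ _ (- (c' / ln 2 ^+ 2))%:E); first exact: ltNyr.
  by apply: (limn_einf_ge (n0 := maxn 2 (maxn n1 n2))) => n /uE /andP[].
- exact: limn_einf_sup.
- apply: (@le_lt_trans _ _ (- (c / ln 2 ^+ 2))%:E).
    by apply: (limn_esup_le (n0 := maxn 2 (maxn n1 n2))) => n /uE /andP[].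
  by rewrite lte_fin oppr_lt0 divr_gt0// exprn_gt0.
Unshelve. all: by end_near.
Qed.
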